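(* Let $M$ be a smooth manifold of dimension $n$ which is immersible in $\mathbf{R}^{n+1}$. Then the complexified tangent bundle $T^cM=TM\otimes\mathbf{C}$ is trivial (as a complex vector bundle) if $M$ is orientable, or if $M$ is non-orientable with $H^2(M,\mathbf{Z})=0$. *)

(* Defs.v *)
From HB Require Import structures.
From mathcomp Require Import all_boot all_order all_algebra.
From mathcomp Require Import all_classical all_reals all_analysis.
From mathcomp Require Import complex.

Set Implicit Arguments.
Unset Strict Implicit.
Unset Printing Implicit Defensive.

Import Order.TTheory GRing.Theory Num.Theory.
Import numFieldNormedType.Exports.

Local Open Scope classical_set_scope.
Local Open Scope ring_scope.

(* [U] is meant to be open and [V], [W] finite-dimensional, so that
   x |-> 'd f x is C^k iff x |-> 'd f x v is C^k for every vector v. *)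
Fixpoint Ck (R : realType) (V W : normedModType R) (k : nat) (U : set V)
    (f : V -> W) : Prop :=
  match k with
  | 0 => {in U, continuous f}
  | k'.+1 => (forall x, U x -> differentiable f x) /\
             (forall v, Ck k' U (fun x => 'd f x v))
  end.

Definition smooth (R : realType) (V W : normedModType R) (U : set V)
    (f : V -> W) : Prop :=
  forall k, Ck k U f.

(* [chart i] and [chart_inv i] are total functions, only relevant on
   [chart_dom i] and on its image. *)
Record smooth_atlas (R : realType) (n : nat) (M : topologicalType) :=
  SmoothAtlas {
    chart_index : Type;
    chart_dom : chart_index -> set M;
    chart : chart_index -> M -> 'rV[R]_n;
    chart_inv : chart_index -> 'rV[R]_n -> M;
    chart_cover : forall x, exists i, chart_dom i x;
    chart_dom_open : forall i, open (chart_dom i);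
    chart_img_open : forall i, open (chart i @` chart_dom i);
    chartK : forall i x, chart_dom i x -> chart_inv i (chart i x) = x;
    chart_continuous : forall i, {in chart_dom i, continuous (chart i)};
    chart_inv_continuous : forall i,
      {in chart i @` chart_dom i, continuous (chart_inv i)};
    chart_smooth : forall i j,
      smooth (chart i @` (chart_dom i `&` chart_dom j))
             (chart j \o chart_inv i) }.

Arguments chart_index {R n M}.
Arguments chart_dom {R n M}.
Arguments chart {R n M}.
Arguments chart_inv {R n M}.

Definition transition (R : realType) (n : nat) (M : topologicalType)
    (A : smooth_atlas R n M) (i j : chart_index A) : 'rV[R]_n -> 'rV[R]_n :=
  chart A j \o chart_inv A i.

Record smooth_manifold (R : realType) (n : nat) := SmoothManifold {
  manifold_space :> topologicalType;
  manifold_hausdorff : hausdorff_space manifold_space;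
  manifold_second_countable : @second_countable manifold_space;
  atlas : smooth_atlas R n manifold_space }.

Definition compatible (R : realType) (n : nat) (M : topologicalType)
    (A B : smooth_atlas R n M) : Prop :=
  forall (i : chart_index A) (j : chart_index B),
    smooth (chart A i @` (chart_dom A i `&` chart_dom B j))
           (chart B j \o chart_inv A i) /\
    smooth (chart B j @` (chart_dom A i `&` chart_dom B j))
           (chart A i \o chart_inv B j).

Definition oriented (R : realType) (n : nat) (M : topologicalType)
    (A : smooth_atlas R n M) : Prop :=
  forall (i j : chart_index A) (x : M), chart_dom A i x -> chart_dom A j x ->
    0 < \det ('J (transition i j) (chart A i x)).

Definition orientable (R : realType) (n : nat) (M : smooth_manifold R n) :
    Prop :=
  exists A : smooth_atlas R n M, compatible (atlas M) A /\ oriented A.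

Definition immersion (R : realType) (n m : nat) (M : smooth_manifold R n)
    (f : M -> 'rV[R]_m) : Prop :=
  forall i : chart_index (atlas M),
    smooth (chart (atlas M) i @` chart_dom (atlas M) i)
           (f \o chart_inv (atlas M) i) /\
    (forall x, chart_dom (atlas M) i x ->
       injective ('d (f \o chart_inv (atlas M) i) (chart (atlas M) i x))).

Definition immersible (R : realType) (n m : nat) (M : smooth_manifold R n) :
    Prop :=
  exists f : M -> 'rV[R]_m, immersion f.

Arguments immersible {R n} m M.

(* A [K]-vector bundle of rank [r]: a family of vector spaces with linear
   coordinates [coord i x] (inverse to [vec i x]) over the members of an open
   cover, such that the transition matrices depend continuously on the base
   point. Only points x of [triv_dom i] are relevant for [coord i x] and
   [vec i x]. *)
Record vector_bundle (K : numFieldType) (B : topologicalType) (r : nat) :=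
  VectorBundle {
    fiber :> B -> lmodType K;
    triv_index : Type;
    triv_dom : triv_index -> set B;
    coord : forall (i : triv_index) (x : B), {linear fiber x -> 'rV[K]_r};
    vec : forall (i : triv_index) (x : B), 'rV[K]_r -> fiber x;
    triv_cover : forall x, exists i, triv_dom i x;
    triv_dom_open : forall i, open (triv_dom i);
    coordK : forall i x, triv_dom i x -> cancel (coord i x) (vec i x);
    vecK : forall i x, triv_dom i x -> cancel (vec i x) (coord i x);
    triv_continuous : forall i j,
      {in triv_dom i `&` triv_dom j,
         continuous (fun x => lin1_mx (coord j x \o vec i x) : 'M[K]_r)} }.

Definition total_space (K : numFieldType) (B : topologicalType) (r : nat)
    (E : vector_bundle K B r) : Type :=
  {x : B & E x}.

Section TotalSpaceTopology.
Variables (K : numFieldType) (B : topologicalType) (r : nat).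
Variable E : vector_bundle K B r.
Local Notation T := (total_space E).

HB.instance Definition _ := gen_eqMixin T.
HB.instance Definition _ := gen_choiceMixin T.

(* The finest topology making all the maps (x, v) |-> vec i x v from
   triv_dom i `*` 'rV[K]_r to the total space continuous. *)
Definition total_open (W : set T) : Prop :=
  forall i : triv_index E,
    open [set p : B * 'rV[K]_r | triv_dom i p.1 /\
                                 W (existT _ p.1 (vec i p.1 p.2))].

Let total_openT : total_open setT.
Proof.
move=> i; have := triv_dom_open i => oi.
rewrite (_ : [set _ | _] = fst @^-1` triv_dom i); last first.
  by apply/seteqP; split=> [p []|p].
by apply: open_comp => // p _; exact: cvg_fst.
Qed.

Let total_openI : setI_closed total_open.
Proof.
move=> U V oU oV i.
rewrite (_ : [set _ | _] = [set p : B * 'rV[K]_r | triv_dom i p.1 /\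
    U (existT _ p.1 (vec i p.1 p.2))] `&` [set p : B * 'rV[K]_r |
    triv_dom i p.1 /\ V (existT _ p.1 (vec i p.1 p.2))]); last first.
  by apply/seteqP; split=> [p [? []]|p [[? ?] []]].
exact: openI.
Qed.

Let total_open_bigU (I : Type) (f : I -> set T) :
  (forall i, total_open (f i)) -> total_open (\bigcup_i f i).
Proof.
move=> of_ i.
rewrite (_ : [set _ | _] = \bigcup_k [set p : B * 'rV[K]_r | triv_dom i p.1 /\
    f k (existT _ p.1 (vec i p.1 p.2))]); last first.
  by apply/seteqP; split=> [p [? [k]]|p [k _ [? ?]]]; [exists k|split=> //; exists k].
by apply: bigcup_open => k _; exact: of_.
Qed.

HB.instance Definition _ := isOpenTopological.Build T
  total_openT total_openI total_open_bigU.

End TotalSpaceTopology.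

Definition bundle_map (K : numFieldType) (B : topologicalType) (r s : nat)
    (E : vector_bundle K B r) (F : vector_bundle K B s)
    (f : forall x, E x -> F x) : total_space E -> total_space F :=
  fun p => existT _ (projT1 p) (f _ (projT2 p)).

Definition bundle_isomorphic (K : numFieldType) (B : topologicalType)
    (r s : nat) (E : vector_bundle K B r) (F : vector_bundle K B s) : Prop :=
  exists (f : forall x, {linear E x -> F x})
         (g : forall x, {linear F x -> E x}),
    [/\ forall x, cancel (f x) (g x), forall x, cancel (g x) (f x),
        continuous (bundle_map f) & continuous (bundle_map g)].

Section TrivialBundle.
Variables (K : numFieldType) (B : topologicalType) (r : nat).

Definition product_fiber : B -> lmodType K := fun=> 'rV[K]_r.

Definition product_coord (i : unit) (x : B) :
    {linear product_fiber x -> 'rV[K]_r} :=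
  idfun.

Let product_cover (x : B) : exists i : unit, (fun=> setT : set B) i x.
Proof. by exists tt. Qed.

Let product_continuous (i j : unit) :
  {in setT `&` setT : set B, continuous (fun x : B =>
    lin1_mx (product_coord j x \o id) : 'M[K]_r)}.
Proof. by move=> x _; exact: cvg_cst. Qed.

Definition product_bundle : vector_bundle K B r :=
  @VectorBundle K B r product_fiber unit (fun=> setT) product_coord
    (fun _ _ => id) product_cover (fun=> openT)
    (fun _ _ _ => fun v => erefl) (fun _ _ _ => fun v => erefl)
    product_continuous.

End TrivialBundle.

Definition trivial_bundle (K : numFieldType) (B : topologicalType) (r : nat)
    (E : vector_bundle K B r) : Prop :=
  bundle_isomorphic E (product_bundle K B r).

Lemma mx_continuous_at (K : numFieldType) (T : topologicalType) (m n : nat)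
    (f : T -> 'M[K]_(m, n)) (x : T) :
  (forall i j, {for x, continuous (fun y => f y i j)}) ->
  {for x, continuous f}.
Proof.
move=> cf U [P PM sPU].
have : \forall y \near x, forall i j, P i j (f y i j).
  by apply: filter_forall => i; apply: filter_forall => j; exact: cf (PM i j).
by apply: filterS => y Py; exact: sPU.
Qed.

Section TangentBundle.
Variables (R : realType) (n : nat) (M : smooth_manifold R n).
Local Notation A := (atlas M).
Local Notation I := (chart_index A).
Implicit Types (i j k : I) (x : M).

Local Lemma overlap_open i j : open (chart A i @` (chart_dom A i `&` chart_dom A j)).
Proof.
rewrite (_ : _ @` _ = (chart A i @` chart_dom A i) `&`
                      chart_inv A i @^-1` chart_dom A j); last first.
  apply/seteqP; split=> [_ [x [ix jx] <-]|_ [[x ix <-]] /=].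
    by split; [exists x|rewrite /= chartK].
  by rewrite chartK // => jx; exists x.
rewrite openE => y [iy jy] /=; apply: filterI.
  by apply: open_nbhs_nbhs; split=> //; exact: chart_img_open.
apply: chart_inv_continuous; first by rewrite inE.
by apply: open_nbhs_nbhs; split=> //; exact: chart_dom_open.
Qed.

Local Lemma transition_differentiable i j x :
  chart_dom A i x -> chart_dom A j x ->
  differentiable (transition i j) (chart A i x).
Proof. by move=> ix jx; have [+ _] := chart_smooth i j 1; apply; exists x. Qed.

Local Lemma transition_chart i j x :
  chart_dom A i x -> transition i j (chart A i x) = chart A j x.
Proof. by move=> ix; rewrite /transition /= chartK. Qed.

Local Lemma diff_transition_id i x v : chart_dom A i x ->
  'd (transition i i) (chart A i x) v = v.
Proof.
move=> ix; rewrite -deriveE; last exact: transition_differentiable.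
rewrite (@near_eq_derive _ _ _ _ id) ?derive_id//.
have : nbhs (chart A i x) (chart A i @` chart_dom A i).
  by apply: open_nbhs_nbhs; split; [exact: chart_img_open|exists x].
by apply: filterS => _ [y iy <-]; rewrite transition_chart.
Qed.

Local Lemma diff_transition_comp i j k x v :
  chart_dom A i x -> chart_dom A j x -> chart_dom A k x ->
  'd (transition j k) (chart A j x) ('d (transition i j) (chart A i x) v) =
  'd (transition i k) (chart A i x) v.
Proof.
move=> ix jx kx.
have dij := transition_differentiable ix jx.
have djk : differentiable (transition j k) (transition i j (chart A i x)).
  by rewrite (transition_chart j ix); exact: transition_differentiable.
transitivity ('D_v (transition i k) (chart A i x)); last first.
  exact: deriveE v (transition_differentiable ix kx).
transitivity ('D_v (transition j k \o transition i j) (chart A i x)).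
  transitivity (('d (transition j k) (transition i j (chart A i x)) \o
                 'd (transition i j) (chart A i x)) v).
    by rewrite /comp (transition_chart j ix).
  rewrite -(diff_comp dij djk); apply/esym.
  exact: deriveE v (differentiable_comp dij djk).
apply: near_eq_derive.
have : nbhs (chart A i x) (chart A i @` (chart_dom A i `&` chart_dom A j)).
  by apply: open_nbhs_nbhs; split; [exact: overlap_open|exists x].
by apply: filterS => _ [y [iy jy] <-]; rewrite /= (transition_chart j iy) (transition_chart k iy) (transition_chart k jy).
Qed.

(* A tangent vector at x is the family of its expressions in all the charts
   around x, related by the differentials of the changes of charts. The
   components at charts not containing x carry no information and are set
   to 0. *)
Definition tangent_vector x : {pred I -> 'rV[R]_n} := fun v =>
  `[< (forall i, ~ chart_dom A i x -> v i = 0) /\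
      (forall i j, chart_dom A i x -> chart_dom A j x ->
         v j = 'd (transition i j) (chart A i x) (v i)) >].

Let tangent_vector_submod x : submod_closed (tangent_vector x).
Proof.
split=> [|a u v]; first by apply/asboolP; split=> [//|i j _ _]; rewrite linear0.
move=> /asboolP[u0 ut] /asboolP[v0 vt]; apply/asboolP.
split=> [i ix|i j ix jx]; rewrite !fctE.
  by rewrite u0// v0// scaler0 addr0.
by rewrite linearP -ut// -vt.
Qed.

HB.instance Definition _ x :=
  GRing.isSubmodClosed.Build R (I -> 'rV[R]_n) (tangent_vector x)
    (tangent_vector_submod x).

Record tangent_space x := TangentVector {
  tangent_family :> I -> 'rV[R]_n;
  tangent_familyP : tangent_family \in tangent_vector x }.

HB.instance Definition _ x := [isSub for @tangent_family x].
HB.instance Definition _ x := [Choice of tangent_space x by <:].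
HB.instance Definition _ x :=
  [SubChoice_isSubLmodule of tangent_space x by <:].

Definition tangent_coord i x : tangent_space x -> 'rV[R]_n := fun v => v i.

Let tangent_coord_linear i x : linear (@tangent_coord i x).
Proof. by []. Qed.

HB.instance Definition _ i x :=
  GRing.isLinear.Build R (tangent_space x) 'rV[R]_n _ (@tangent_coord i x)
    (@tangent_coord_linear i x).

Definition tangent_family_of i x (w : 'rV[R]_n) : I -> 'rV[R]_n := fun j =>
  if `[< chart_dom A i x /\ chart_dom A j x >]
  then 'd (transition i j) (chart A i x) w else 0.

Let tangent_family_ofP i x w : tangent_family_of i x w \in tangent_vector x.
Proof.
apply/asboolP; split=> [j jx|j k jx kx]; rewrite /tangent_family_of.
  by case: asboolP => // -[].
case: asboolP => [[ix _]|nijx]; case: asboolP => [[ix' _]|nikx].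
- exact: esym (diff_transition_comp w ix jx kx).
- by case: nikx.
- by case: nijx.
- by move: (linear0 ('d (transition j k) (chart A j x))) => ->.
Qed.

Definition tangent_vec i x (w : 'rV[R]_n) : tangent_space x :=
  TangentVector (tangent_family_ofP i x w).

Let tangent_coordK i x : chart_dom A i x ->
  cancel (@tangent_coord i x) (@tangent_vec i x).
Proof.
move=> ix v; apply/val_inj/funext => j /=.
have /asboolP[v0 vt] := tangent_familyP v.
rewrite /tangent_family_of; case: asboolP => [[_ jx]|nijx].
  by rewrite -vt.
by rewrite v0// => jx; apply: nijx.
Qed.

Let tangent_vecK i x : chart_dom A i x ->
  cancel (@tangent_vec i x) (@tangent_coord i x).
Proof.
move=> ix w; rewrite /tangent_coord /= /tangent_family_of asboolT//.
exact: diff_transition_id.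
Qed.

Let tangent_continuous i j : {in chart_dom A i `&` chart_dom A j,
  continuous (fun x => lin1_mx (@tangent_coord j x \o tangent_vec i x))}.
Proof.
move=> x; rewrite inE => -[ix jx].
pose J y : 'M[R]_n := lin1_mx ('d (transition i j) (chart A i y)).
have near_overlap : \forall y \near x, chart_dom A i y /\ chart_dom A j y.
  apply: (@open_nbhs_nbhs _ x (chart_dom A i `&` chart_dom A j)); split=> //.
  by apply: openI; exact: chart_dom_open.
rewrite /continuous_at [X in _ --> X](_ : _ = J x); last first.
  apply/matrixP => a b; rewrite !mxE /= /tangent_coord /=.
  by rewrite /tangent_family_of asboolT.
have cJ : {for x, continuous J}.
  apply: mx_continuous_at => a b.
  have [_ /(_ (delta_mx 0 a)) cd] := chart_smooth i j 1.
  have c1 : {for x, continuous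
      (fun y => 'd (transition i j) (chart A i y) (delta_mx 0 a))}.
    apply: (@continuous_comp _ _ _ (chart A i)
      (fun z => 'd (transition i j) z (delta_mx 0 a))).
      by apply: chart_continuous; rewrite inE.
    by apply: cd; rewrite inE; exists x.
  rewrite /J (_ : (fun y => _) = (fun N : 'rV[R]_n => N 0 b) \o
      (fun y => 'd (transition i j) (chart A i y) (delta_mx 0 a))); last first.
    by apply/funext => y; rewrite mxE.
  by apply: continuous_comp; [exact: c1|exact: coord_continuous].
apply: cvg_trans cJ; apply: near_eq_cvg.
apply: filterS near_overlap => y [iy jy].
apply/matrixP => a b; rewrite !mxE /= /tangent_coord /=.
by rewrite /tangent_family_of asboolT.
Qed.

Definition tangent_bundle : vector_bundle R M n :=
  @VectorBundle R M n tangent_space I (chart_dom A)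
    (fun i x => @tangent_coord i x) tangent_vec
    (@chart_cover _ _ _ A) (@chart_dom_open _ _ _ A)
    tangent_coordK tangent_vecK tangent_continuous.

End TangentBundle.

Definition complexes (R : realType) : numFieldType := R[i]%C.

(* V (x)_R C, with the pair (u, v) standing for u (x) 1 + v (x) i. *)
Definition complexification (R : realType) (V : lmodType R) : Type :=
  (V * V)%type.

Section Complexification.
Variables (R : realType) (V : lmodType R).
Local Notation VC := (complexification V).

HB.instance Definition _ := GRing.Zmodule.copy VC (V * V)%type.

Definition complexification_scale (z : complexes R) (w : VC) : VC :=
  (complex.Re z *: w.1 - complex.Im z *: w.2,
   complex.Re z *: w.2 + complex.Im z *: w.1).

Let scaleA z1 z2 w : complexification_scale z1 (complexification_scale z2 w) =
  complexification_scale (z1 * z2) w.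
Proof.
case: z1 z2 w => [a b] [c d] [u v]; congr pair; rewrite /=.
  rewrite scalerBr scalerDr scalerBl scalerDl !scalerA !opprD -!addrA.
  by congr (_ + _); rewrite [RHS]addrC addrA.
rewrite scalerBr scalerDr scalerBl scalerDl !scalerA -!addrA.
by congr (_ + _); rewrite [RHS]addrC addrA.
Qed.

Let scale1 : left_id 1 complexification_scale.
Proof.
by case=> u v; congr pair; rewrite /= !scale1r !scale0r ?subr0 ?addr0.
Qed.

Let scaleDr : right_distributive complexification_scale +%R.
Proof.
move=> [a b] [u v] [u' v']; congr pair; rewrite /= !scalerDr.
  by rewrite opprD addrACA.
by rewrite addrACA.
Qed.

Let scaleDl w : {morph complexification_scale^~ w : a b / a + b}.
Proof.
move=> [a b] [c d]; case: w => u v; congr pair; rewrite /= !scalerDl.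
  by rewrite opprD addrACA.
by rewrite addrACA.
Qed.

HB.instance Definition _ := GRing.Zmodule_isLmodule.Build (complexes R) VC
  scaleA scale1 scaleDr scaleDl.

End Complexification.

Lemma real_complex_continuous (R : realType) :
  continuous (real_complex R : R -> complexes R).
Proof.
move=> x; apply/cvgrPdist_lt => -[e e'] /=; rewrite ltcE /= => /andP[/eqP -> e0].
near=> y; rewrite -rmorphB normc_def /= expr0n /= addr0 sqrtr_sqr ltcR.
by near: y; exact: (@cvgr_dist_lt _ _ _ _ _ id).
Unshelve. all: by end_near. Qed.

Section ComplexifiedBundle.
Variables (R : realType) (B : topologicalType) (r : nat).
Variable E : vector_bundle R B r.
Local Notation C := (complexes R).

Definition complexified_fiber (x : B) : lmodType C := complexification (E x).

Definition complexified_coord (i : triv_index E) (x : B)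
    (w : complexified_fiber x) : 'rV[C]_r :=
  \row_j (coord i x w.1 0 j +i* coord i x w.2 0 j)%C.

Let complexified_coord_linear i x : linear (@complexified_coord i x).
Proof.
move=> [a b] [u v] [u' v']; apply/rowP => j; rewrite !mxE /=.
rewrite !(raddfD, raddfN) /= !linearZZ !mxE.
by apply/eqP; rewrite eq_complex /= mulrN !eqxx.
Qed.

HB.instance Definition _ i x := GRing.isLinear.Build C (complexified_fiber x)
  'rV[C]_r _ (@complexified_coord i x) (@complexified_coord_linear i x).

Definition complexified_vec (i : triv_index E) (x : B) (w : 'rV[C]_r) :
    complexified_fiber x :=
  (vec i x (map_mx (@complex.Re R) w), vec i x (map_mx (@complex.Im R) w)).

Let complexified_coordK i x : triv_dom i x ->
  cancel (@complexified_coord i x) (complexified_vec i x).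
Proof.
move=> ix [u v]; congr pair; rewrite /= -[RHS](coordK ix); congr vec.
  by apply/rowP => j; rewrite !mxE.
by apply/rowP => j; rewrite !mxE.
Qed.

Let complexified_vecK i x : triv_dom i x ->
  cancel (complexified_vec i x) (@complexified_coord i x).
Proof.
move=> ix w; apply/rowP => j; rewrite !mxE /= !(vecK ix) !mxE.
by case: (w 0 j).
Qed.

Let complexified_continuous i j : {in triv_dom i `&` triv_dom j,
  continuous (fun x => lin1_mx (@complexified_coord j x \o complexified_vec i x)
                       : 'M[C]_r)}.
Proof.
move=> x xij.
pose J y : 'M[R]_r := lin1_mx (coord j y \o vec i y).
pose JC y : 'M[C]_r := map_mx (real_complex R) (J y).
have JE y : triv_dom i y -> JC y =
    lin1_mx (@complexified_coord j y \o complexified_vec i y).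
  move=> iy; apply/matrixP => a b; rewrite !mxE /=.
  have -> : map_mx (@complex.Re R) (delta_mx 0 a : 'rV[C]_r) = delta_mx 0 a.
    by apply/rowP => c; rewrite !mxE; case: (_ && _).
  have -> : map_mx (@complex.Im R) (delta_mx 0 a : 'rV[C]_r) = 0.
    by apply/rowP => c; rewrite !mxE; case: (_ && _).
  by rewrite -(linear0 (coord i y)) (coordK iy) linear0 mxE.
rewrite /continuous_at -JE; last by move: xij; rewrite inE => -[].
have cJC : {for x, continuous JC}.
  apply: mx_continuous_at => a b.
  rewrite (_ : (fun y => _) =
      real_complex R \o (fun N : 'M[R]_r => N a b) \o J); last first.
    by apply/funext => y; rewrite /JC mxE.
  apply: continuous_comp; first exact: triv_continuous.
  apply: continuous_comp; first exact: coord_continuous.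
  exact: real_complex_continuous.
apply: cvg_trans cJC; apply: near_eq_cvg.
have : \forall y \near x, triv_dom i y.
  apply: open_nbhs_nbhs; split; first exact: triv_dom_open.
  by move: xij; rewrite inE => -[].
by apply: filterS => y iy; exact: JE.
Qed.

Definition complexified_bundle : vector_bundle C B r :=
  @VectorBundle C B r complexified_fiber (triv_index E) (@triv_dom _ _ _ E)
    (fun i x => @complexified_coord i x) complexified_vec
    (@triv_cover _ _ _ E) (@triv_dom_open _ _ _ E)
    complexified_coordK complexified_vecK complexified_continuous.

End ComplexifiedBundle.

Definition std_simplex (R : realType) (k : nat) : set 'rV[R]_k.+1 :=
  [set t | (forall i, 0 <= t 0 i) /\ \sum_i t 0 i = 1].

Arguments std_simplex : clear implicits.

Definition singular_simplex (R : realType) (k : nat) (X : topologicalType) :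
    Type :=
  continuousType (std_simplex R k) X.

Arguments singular_simplex : clear implicits.

Section Face.
Variables (R : realType) (k : nat) (j : 'I_k.+2).

Definition face_vec (t : 'rV[R]_k.+1) : 'rV[R]_k.+2 :=
  \row_i (if unlift j i is Some i' then t 0 i' else 0).

Let face_in (t : std_simplex R k) : face_vec (val t) \in std_simplex R k.+1.
Proof.
case: t => t /=; rewrite !inE => -[t0 t1]; split.
  by move=> i; rewrite mxE; case: unliftP.
rewrite (bigD1_ord j) //= mxE unlift_none add0r -[RHS]t1.
by apply: eq_bigr => i _; rewrite mxE liftK.
Qed.

Definition face (t : std_simplex R k) : std_simplex R k.+1 :=
  exist _ (face_vec (val t)) (face_in t).

Let face_continuous : continuous face.
Proof.
apply: continuous_comp_initial => t.
apply: (@continuous_comp _ _ _ (val : std_simplex R k -> 'rV[R]_k.+1) face_vec).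
  exact: initial_continuous.
apply: mx_continuous_at => a b.
have -> : (fun y => face_vec y a b) = fun y : 'rV[R]_k.+1 =>
    if unlift j b is Some i' then y 0 i' else 0.
  by apply/funext => y; rewrite mxE.
case: (unlift j b) => [i'|]; first exact: coord_continuous.
exact: (@cst_continuous _ _ (0 : R)).
Qed.

HB.instance Definition _ := isContinuous.Build _ _ face face_continuous.

End Face.

Section Cohomology.
Variables (R : realType) (X : topologicalType).

Definition cochain (k : nat) : Type := singular_simplex R k X -> int.

Definition coboundary (k : nat) (c : cochain k) : cochain k.+1 := fun s =>
  \sum_(j < k.+2) (-1) ^+ j * c (s \o face j).

Definition cocycle (k : nat) (c : cochain k) : Prop :=
  forall s, coboundary c s = 0.

(* Degree k of the cohomology of Hom(C_*(X), Z): cochains are given by their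
   values on the basis of singular simplices. *)
Definition singular_cohomology_vanishes (k : nat) : Prop :=
  match k with
  | 0 => forall c : cochain 0, cocycle c -> c = cst 0
  | k'.+1 => forall c : cochain k'.+1, cocycle c ->
               exists b : cochain k', c = coboundary b
  end.

End Cohomology.

Arguments singular_cohomology_vanishes : clear implicits.

(* Main.v *)
From HB Require Import structures.
From mathcomp Require Import all_boot all_order all_algebra.
From mathcomp Require Import all_classical all_reals all_analysis.
From mathcomp Require Import complex.
From mathcomp Require Import ring lra.
Require Import Defs.

Set Implicit Arguments.
Unset Strict Implicit.
Unset Printing Implicit Defensive.

Import Order.TTheory GRing.Theory Num.Theory.
Import numFieldNormedType.Exports.

Local Open Scope classical_set_scope.
Local Open Scope ring_scope.

(** The immersion f gives at each point x of M a normal line in R^(n+1),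
    spanned by a unit vector N x determined up to sign, and T_xM is the
    orthogonal complement of N x. After complexification N x may be multiplied
    by any complex number of modulus 1, and everything rests on this claim: if
    there are phases z x, of modulus 1, such that the field z x * N x is
    continuous, then the complexified tangent bundle is trivial.

    Usually the claim is a matter of dimension: the map x |-> z x * N x from M
    to the sphere S^(2n+1) is null-homotopic, hence lifts to U(n+1). It also has
    an explicit proof, because the vector a = 3/4 (e_0 + i e_1) is not a
    multiple of any real vector. The vector k = z N - a is then
    never orthogonal to N, so the projection along k is injective on the
    complexification of N^perp, and the linear form e_0^* - i e_1^* never
    vanishes on k, so the quotient of C^(n+1) by the line of k is identified
    with a fixed C^n ([splitting_unit]). These linear maps depend continuously
    on x and trivialize the bundle ([trivial_complexified_tangent]); for n = 0
    there is nothing to do.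

    If M is orientable, N can be chosen continuous, by normalizing the cross
    product of the partial derivatives of f in an oriented chart
    ([exists_continuous_normal_field]), and z = 1 works.

    In general, send a path in M to 1 if the normal line is reversed along it,
    relatively to the chosen N at its ends, and to 0 otherwise. The coboundary of
    this integral cochain w is even on every 2-simplex, since the normal line has
    a continuous nonvanishing section over a simplex, and half of it is a
    cocycle, the Bockstein of w, which represents the Chern class of the
    complexified normal line. When H^2(M; Z) = 0, this cocycle is the
    coboundary of some b, and W = w - 2b is an integral 1-cocycle that reduces
    to w modulo 2 ([exists_integral_lift]). On a convex cell, W of
    any path from y to x is h y - h x, where h y is W of the segment from y to a
    fixed point of the cell; averaging these local primitives h with a partition
    of unity gives a real function theta on M.
    Near a point x, theta differs from W of the segment from y to x by a
    continuous function, and N y multiplied by (-1) to this power is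
    continuous, so z = exp(i pi theta) works ([exists_phase]). *)

(** * Continuity of matrix expressions *)

Lemma near_eq_continuous_at (T U : topologicalType) (f g : T -> U) (x : T) :
  (\forall y \near x, g y = f y) -> {for x, continuous g} ->
  {for x, continuous f}.
Proof.
move=> gf cg; rewrite /prop_for /continuous_at -(nbhs_singleton gf).
by apply: cvg_trans cg; exact: near_eq_cvg.
Qed.

Lemma continuous_at_pair (T U V : topologicalType) (f : T -> U) (g : T -> V) t :
  {for t, continuous f} -> {for t, continuous g} ->
  {for t, continuous (fun u => (f u, g u))}.
Proof.
by move=> cf cg; exact: (@cvg_pair _ _ _ (nbhs t) (nbhs (f t)) (nbhs (g t))).
Qed.

Section MatrixContinuity.
Variables (K : numFieldType) (T : topologicalType) (x : T).

Lemma continuous_at_sum (I : Type) (r : seq I) (P : pred I) (F : I -> T -> K) :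
  (forall i, P i -> {for x, continuous (F i)}) ->
  {for x, continuous (fun y => \sum_(i <- r | P i) F i y)}.
Proof. by move=> cF; apply: cvg_big => //; exact: add_continuous. Qed.

Lemma continuous_at_prod (I : Type) (r : seq I) (P : pred I) (F : I -> T -> K) :
  (forall i, P i -> {for x, continuous (F i)}) ->
  {for x, continuous (fun y => \prod_(i <- r | P i) F i y)}.
Proof. by move=> cF; apply: cvg_big => //; exact: mul_continuous. Qed.

Lemma continuous_at_entry m n (A : T -> 'M[K]_(m, n)) i j :
  {for x, continuous A} -> {for x, continuous (fun y => A y i j)}.
Proof.
by move=> cA; apply: (@continuous_comp _ _ _ A (fun N : 'M[K]_(m, n) => N i j));
  [exact: cA|exact: coord_continuous].
Qed.

Lemma continuous_at_mulmx m n p (A : T -> 'M[K]_(m, n)) (B : T -> 'M[K]_(n, p)) :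
  {for x, continuous A} -> {for x, continuous B} ->
  {for x, continuous (fun y => A y *m B y)}.
Proof.
move=> cA cB; apply: mx_continuous_at => i j.
under [X in {for x, continuous X}]eq_fun do rewrite mxE.
by apply: continuous_at_sum => k _; apply: continuousM; exact: continuous_at_entry.
Qed.

Lemma continuous_at_det n (A : T -> 'M[K]_n) :
  {for x, continuous A} -> {for x, continuous (fun y => \det (A y))}.
Proof.
move=> cA; apply: continuous_at_sum => s _; apply: continuousM.
  exact: cvg_cst.
by apply: continuous_at_prod => i _; exact: continuous_at_entry.
Qed.

Lemma continuous_at_cofactor n (A : T -> 'M[K]_n) i j :
  {for x, continuous A} -> {for x, continuous (fun y => cofactor (A y) i j)}.
Proof.
move=> cA; apply: continuousM; first exact: cvg_cst.
apply: continuous_at_det; apply: mx_continuous_at => a b.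
under [X in {for x, continuous X}]eq_fun do rewrite !mxE.
exact: continuous_at_entry.
Qed.

Lemma continuous_at_invmx n (A : T -> 'M[K]_n) :
  (\forall y \near x, A y \in unitmx) -> {for x, continuous A} ->
  {for x, continuous (fun y => invmx (A y))}.
Proof.
move=> uA cA.
apply: (@near_eq_continuous_at _ _ _ (fun y => (\det (A y))^-1 *: \adj (A y))).
  by apply: filterS uA => y uy; rewrite /invmx uy.
apply: mx_continuous_at => i j.
under [X in {for x, continuous X}]eq_fun do rewrite !mxE.
apply: (@continuousM _ _ (fun y => (\det (A y))^-1) (fun y => cofactor (A y) j i));
  last exact: continuous_at_cofactor.
apply: (@continuousV _ _ (fun y => \det (A y))); last exact: continuous_at_det.
by rewrite -unitfE -unitmxE; exact: nbhs_singleton uA.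
Qed.

End MatrixContinuity.

Lemma continuous_at_trmx (K : numFieldType) (T : topologicalType) (x : T) m n
    (A : T -> 'M[K]_(m, n)) :
  {for x, continuous A} -> {for x, continuous (fun y => (A y)^T)}.
Proof.
move=> cA; apply: mx_continuous_at => i j.
rewrite (_ : (fun y => _) = fun y => A y j i); last first.
  by apply/funext => y; rewrite mxE.
exact: continuous_at_entry.
Qed.

Lemma continuous_at_scale (R : realType) n (T : topologicalType) (a : T -> R)
    (v : T -> 'rV[R]_n) t :
  {for t, continuous a} -> {for t, continuous v} ->
  {for t, continuous (fun u => a u *: v u)}.
Proof. by move=> ca cv; exact: continuousZ. Qed.

Lemma continuous_at_add (R : realType) n (T : topologicalType)
    (v w : T -> 'rV[R]_n) t :
  {for t, continuous v} -> {for t, continuous w} ->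
  {for t, continuous (fun u => v u + w u)}.
Proof. by move=> cv cw; exact: continuousD. Qed.

(** For a scalar h that may be discontinuous at t, as the quotient of two
    barycentric coordinates is where both vanish. *)
Lemma continuous_at_bounded_scale (R : realType) n (T : topologicalType) (h : T -> R)
    (v : T -> 'rV[R]_n) t :
  (forall u, `|h u| <= 1) -> v t = 0 -> {for t, continuous v} ->
  {for t, continuous (fun u => h u *: v u)}.
Proof.
move=> h1 v0; rewrite /prop_for /continuous_at v0 scaler0 => cv.
apply/cvgr0Pnorm_lt => e e0; near=> u; rewrite normrZ.
apply: le_lt_trans (_ : `|v u| < e); first by rewrite ler_piMl.
by near: u; exact: cvgr0_norm_lt.
Unshelve. all: by end_near. Qed.

(** * A criterion for triviality *)

(** A version of [mul_rV_lin1] for functions such as [vec i x], which are linear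
    only under a condition on x and so carry no linear structure. *)
Lemma mul_rV_lin1_linear (K : comNzRingType) m n (g : 'rV[K]_m -> 'rV[K]_n) :
  linear g -> forall w, w *m lin1_mx g = g w.
Proof.
move=> lg w.
pose gL : {linear 'rV[K]_m -> 'rV[K]_n} :=
  HB.pack g (GRing.isLinear.Build _ _ _ _ g lg).
exact: (mul_rV_lin1 gL).
Qed.

Lemma total_openE (K : numFieldType) (B : topologicalType) (r : nat)
    (E : vector_bundle K B r) (W : set (total_space E)) :
  open W = total_open W.
Proof. by []. Qed.

(** The inverse of a fibrewise isomorphism is given in a local trivialization by
    the inverse matrices, whose continuity is that of the cofactors; only the
    continuity of the map itself has to be assumed. *)
Section TrivialBundleCriterion.
Variables (K : numFieldType) (B : topologicalType) (r : nat).
Variable E : vector_bundle K B r.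
Variable f : forall x, {linear E x -> 'rV[K]_r}.
Hypothesis f_inj : forall x, injective (f x).
Hypothesis f_continuous : forall i, {in triv_dom i,
  continuous (fun x => lin1_mx (f x \o vec i x) : 'M[K]_r)}.

Let A (i : triv_index E) (x : B) : 'M[K]_r := lin1_mx (f x \o vec i x).

Lemma vec_linear (i : triv_index E) x : triv_dom i x -> linear (vec i x).
Proof.
move=> ix a u v; apply: (can_inj (coordK ix)).
by rewrite linearP !(vecK ix).
Qed.

Let f_vec i x w : triv_dom i x -> f x (vec i x w) = w *m A i x.
Proof.
move=> ix; rewrite mul_rV_lin1_linear// => a u v /=.
by rewrite vec_linear// linearP.
Qed.

Let A_unit i x : triv_dom i x -> A i x \in unitmx.
Proof.
move=> ix; rewrite -row_free_unit; apply: inj_row_free => w.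
rewrite -f_vec// => fw0; rewrite -[w](vecK ix).
have -> : vec i x w = 0 by apply: f_inj; rewrite fw0 linear0.
exact: linear0.
Qed.

Let ix x : triv_index E := sval (cid (triv_cover E x)).
Let ixP x : triv_dom (ix x) x := svalP (cid (triv_cover E x)).
Let g x (w : product_fiber K r x) : E x := vec (ix x) x (w *m invmx (A (ix x) x)).

Let gK x : cancel (@g x) (f x).
Proof. by move=> w; rewrite f_vec // mulmxKV // A_unit. Qed.

Let fK x : cancel (f x) (@g x).
Proof. by move=> v; apply: f_inj; rewrite gK. Qed.

Let g_linear x : linear (@g x).
Proof. by move=> a u v; apply: f_inj; rewrite linearP !gK. Qed.

HB.instance Definition _ x := GRing.isLinear.Build K (product_fiber K r x) (E x) _
  (@g x) (@g_linear x).

Let gE i x w : triv_dom i x -> g w = vec i x (w *m invmx (A i x)).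
Proof.
by move=> iix; apply: f_inj; rewrite gK f_vec // mulmxKV // A_unit.
Qed.

Lemma trivial_bundle_of_injective : trivial_bundle E.
Proof.
exists f, (fun x => @g x); split=> //.
  apply/continuousP => W; rewrite !total_openE => oW i.
  rewrite openE => -[x v] /= [iix Wv].
  have oi : \forall p \near (x, v), triv_dom i p.1.
    apply: (@cvg_fst _ _ (nbhs x) (nbhs v)).
    by apply: open_nbhs_nbhs; split => //; exact: triv_dom_open.
  have := oW tt; rewrite openE => /(_ (x, v *m A i x)) /= oW'.
  have cf : {for (x, v), continuous (fun p : B * 'rV[K]_r => (p.1, p.2 *m A i p.1))}.
    apply: (@cvg_pair _ _ _ (nbhs (x, v)) (nbhs x) (nbhs (v *m A i x)));
      first exact: cvg_fst.
    apply: (@continuous_at_mulmx K _ (x, v) _ _ _ snd (A i \o fst)); first exact: cvg_snd.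
    apply: (@continuous_comp _ _ _ fst (A i)); first exact: cvg_fst.
    by apply: f_continuous; rewrite inE.
  have : \forall p \near (x, v), (setT : set B) p.1 /\
      W (existT (product_fiber K r) p.1 (p.2 *m A i p.1)).
    by apply: (cf _ (oW' _)); split=> //; rewrite -f_vec.
  move=> Wn; near=> p; split; first by near: p.
  rewrite /bundle_map /= f_vec //; last by near: p.
  suff : setT p.1 /\ W (existT (product_fiber K r) p.1 (p.2 *m A i p.1)) by case.
  by near: p.
apply/continuousP => W; rewrite !total_openE => oW i.
rewrite openE => -[x w] /= [_ Wg].
pose j := ix x.
have oj : \forall p \near (x, w), triv_dom j p.1.
  apply: (@cvg_fst _ _ (nbhs x) (nbhs w)).
  by apply: open_nbhs_nbhs; split => //; [exact: triv_dom_open|exact: ixP].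
have := oW j; rewrite openE => /(_ (x, w *m invmx (A j x))) /= oW'.
have cf : {for (x, w), continuous
    (fun p : B * 'rV[K]_r => (p.1, p.2 *m invmx (A j p.1)))}.
  apply: (@cvg_pair _ _ _ (nbhs (x, w)) (nbhs x) (nbhs (w *m invmx (A j x))));
    first exact: cvg_fst.
  apply: (@continuous_at_mulmx K _ (x, w) _ _ _ snd (fun p => invmx (A j p.1))); first exact: cvg_snd.
  apply: continuous_at_invmx.
    by apply: filterS oj => p jp; exact: A_unit.
  apply: (@continuous_comp _ _ _ fst (A j)); first exact: cvg_fst.
  by apply: f_continuous; rewrite inE; exact: ixP.
have Wn : \forall p \near (x, w), triv_dom j p.1 /\
    W (existT (fun x => E x) p.1 (vec j p.1 (p.2 *m invmx (A j p.1)))).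
  by apply: (cf _ (oW' _)); split=> //; exact: ixP.
near=> p; split => //.
have [|jp Wp] := near Wn p; first by [].
by rewrite /bundle_map /= (gE _ jp).
Unshelve. all: by end_near. Qed.

End TrivialBundleCriterion.

(** A fibrewise isomorphism to K^r can be given by invertible matrices G i x in
    each trivialization, provided that they are exchanged by the transition
    matrices: the map v |-> coord i x v *m G i x is then the same for all i. *)
Section TrivialBundleOfFrames.
Variables (K : numFieldType) (B : topologicalType) (r : nat).
Variable E : vector_bundle K B r.
Variable G : triv_index E -> B -> 'M[K]_r.
Hypothesis G_unit : forall i x, triv_dom i x -> G i x \in unitmx.
Hypothesis G_continuous : forall i, {in triv_dom i, continuous (G i)}.
Hypothesis G_change : forall i j x, triv_dom i x -> triv_dom j x ->
  G i x = lin1_mx (coord j x \o vec i x) *m G j x.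

Let ix x : triv_index E := sval (cid (triv_cover E x)).
Let ixP x : triv_dom (ix x) x := svalP (cid (triv_cover E x)).

Lemma trivial_bundle_of_frames : trivial_bundle E.
Proof.
pose f x : {linear E x -> 'rV[K]_r} := mulmxr (G (ix x) x) \o coord (ix x) x.
have fE i x w : triv_dom i x -> f x (vec i x w) = w *m G i x.
  move=> iix; rewrite (G_change iix (ixP x)) mulmxA; congr (_ *m _).
  rewrite mul_rV_lin1_linear //= => a u v /=.
  by rewrite vec_linear// linearP.
apply: (@trivial_bundle_of_injective _ _ _ _ f) => [x u v|i x].
  rewrite /f /= => /(congr1 (fun w => w *m invmx (G (ix x) x))).
  have Gu := G_unit (ixP x); rewrite !mulmxK //.
  by move=> /(can_inj (coordK (ixP x))).
rewrite inE => iix.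
apply: (@near_eq_continuous_at _ _ _ (G i)); last by apply: G_continuous; rewrite inE.
have : \forall y \near x, triv_dom i y.
  by apply: open_nbhs_nbhs; split => //; exact: triv_dom_open.
apply: filterS => y iy; apply/row_matrixP => a; rewrite !rowE -fE //.
rewrite mul_rV_lin1_linear // => b u v.
by rewrite /comp vec_linear// linearP.
Qed.

End TrivialBundleOfFrames.

(** Complex coordinates change by the real transition matrices, so the frames
    of a complexified bundle are compared by real Jacobians. *)
Lemma complexified_transition (R : realType) (B : topologicalType) (r : nat)
    (E : vector_bundle R B r) (i j : triv_index E) (x : B) :
  triv_dom i x ->
  lin1_mx (@complexified_coord _ _ _ E j x \o complexified_vec i x) =
  map_mx (real_complex R) (lin1_mx (coord j x \o vec i x)).
Proof.
move=> iix; apply/matrixP => a b; rewrite !mxE /=.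
have -> : map_mx (@complex.Re R) (delta_mx 0 a : 'rV[complexes R]_r) = delta_mx 0 a.
  by apply/rowP => c; rewrite !mxE; case: (_ && _).
have -> : map_mx (@complex.Im R) (delta_mx 0 a : 'rV[complexes R]_r) = 0.
  by apply/rowP => c; rewrite !mxE; case: (_ && _).
by rewrite -(linear0 (coord i x)) (coordK iix) linear0 mxE.
Qed.

Lemma continuous_at_complex (R : realType) (T : topologicalType) (x : T)
    (a b : T -> R) : {for x, continuous a} -> {for x, continuous b} ->
  {for x, continuous (fun y => (a y +i* b y)%C : complexes R)}.
Proof.
move=> ca cb.
rewrite (_ : (fun y => _) = (fun y => real_complex R (a y) +
   ('i%C : complexes R) * real_complex R (b y))); last first.
  apply/funext => y; apply/eqP.
  by rewrite eq_complex /= !mul0r !mul1r !subr0 ?addr0 ?add0r ?subrr !eqxx.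
apply: continuousD.
  by apply: (continuous_comp ca); exact: real_complex_continuous.
apply: continuousM; first exact: cvg_cst.
by apply: (continuous_comp cb); exact: real_complex_continuous.
Qed.

(** * Trivializing the complement of a rotated real unit vector *)

Section Splitting.
Variables (R : realType) (m : nat).
Local Notation C := (complexes R).
Implicit Types u v : 'rV[R]_m.+2.

Let e0 : 'I_m.+2 := ord0.
Let e1 : 'I_m.+2 := lift ord0 ord0.

(** As a linear form, v |-> v_0 - i v_1. It has modulus at most 1 on z N for N a
    real unit vector and |z| = 1, and takes the value 3/2 on
    3/4 (e_0 + i e_1). *)
Definition isotropic : 'cV[C]_m.+2 := delta_mx e0 0 - ('i%C : C) *: delta_mx e1 0.

(** The vector k = (u + i v) - 3/4 (e_0 + i e_1), used for u + i v = z N. The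
    coefficient 3/4 lies strictly between 1/2, above which [isotropic] does
    not vanish on k, and 1, below which k is not orthogonal to N. *)
Definition transversal u v : 'rV[C]_m.+2 :=
  \row_j (u 0 j +i* v 0 j)%C -
  (3 / 4)%:C%C *: (delta_mx 0 e0 + ('i%C : C) *: delta_mx 0 e1).

(** The projection onto the kernel of [isotropic] along [transversal u v],
    followed by the isomorphism of this kernel with C^(m+1) that forgets the
    coordinate 0, which is i times the coordinate 1 there. *)
Definition splitting u v : 'M[C]_(m.+2, m.+1) :=
  col' ord0 (1%:M - ((transversal u v *m isotropic) 0 0)^-1 *:
                     (isotropic *m transversal u v)).

Lemma mulmx_isotropic (w : 'rV[C]_m.+2) :
  (w *m isotropic) 0 0 = w 0 e0 - ('i%C : C) * w 0 e1.
Proof. by rewrite mulmxBr -scalemxAr -!colE !mxE. Qed.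

Lemma transversalE u v j : transversal u v 0 j = (u 0 j +i* v 0 j)%C -
  (3 / 4)%:C%C * ((j == e0)%:R + ('i%C : C) * (j == e1)%:R).
Proof. by rewrite !mxE. Qed.

Lemma complex_rowE u v : (\row_j (u 0 j +i* v 0 j)%C : 'rV[C]_m.+2) =
  map_mx (real_complex R) u + ('i%C : C) *: map_mx (real_complex R) v.
Proof.
apply/rowP => j; rewrite !mxE /=; apply/eqP; rewrite eq_complex /=.
by apply/andP; split; apply/eqP; ring.
Qed.

Section RotatedUnitVector.
Variables (N : 'rV[R]_m.+2) (c s : R).
Hypothesis N1 : N *m N^T = 1%:M.
Hypothesis cs1 : c ^+ 2 + s ^+ 2 = 1.
Local Notation k := (transversal (c *: N) (s *: N)).

Lemma unit_coord_le1 : N 0 e0 ^+ 2 + N 0 e1 ^+ 2 <= 1.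
Proof.
have <- : \sum_j N 0 j * N^T j 0 = 1.
  by have := congr1 (fun A : 'M[R]_1 => A 0 0) N1; rewrite mxE [RHS]mxE.
rewrite (bigD1 e0) //= (bigD1 e1) //= !mxE addrA -!expr2 lerDl.
by apply: sumr_ge0 => j _; rewrite mxE -expr2 sqr_ge0.
Qed.

(** The real part is c N_0 + s N_1 - 3/2, and c N_0 + s N_1 is at most 1 by the
    inequality between arithmetic and geometric means. *)
Lemma transversal_isotropic_neq0 : (k *m isotropic) 0 0 != 0.
Proof.
rewrite mulmx_isotropic !transversalE /= eq_complex /= !mxE.
apply/negP => /andP[/eqP + _] /=.
have := unit_coord_le1.
rewrite !(mulr1, mulr0, mul0r, mul1r, subr0, addr0, add0r, sub0r, mulrN, mulNr, opprK, oppr0).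
have := sqr_ge0 (c - N 0 e0); have := sqr_ge0 (s - N 0 e1).
by move: cs1; rewrite !sqrrB !mulr2n => *; lra.
Qed.

(** The bilinear product of k and N is z - 3/4 (N_0 + i N_1), where z has modulus
    1 and the other term has modulus at most 3/4. *)
Lemma transversal_normal_neq0 : (k *m map_mx (real_complex R) N^T) 0 0 != 0.
Proof.
have -> : (k *m map_mx (real_complex R) N^T) 0 0 =
    ((c - 3 / 4 * N 0 e0) +i* (s - 3 / 4 * N 0 e1))%C.
  rewrite /transversal complex_rowE mulmxBl -scalemxAl !mulmxDl -!scalemxAl.
  rewrite -!rowE -!map_mxM /= -!scalemxAl N1 !mxE /= !mulr1n.
  apply/eqP; rewrite eq_complex /=.
  by apply/andP; split; apply/eqP; ring.
rewrite eq_complex /=; apply/negP => /andP[/eqP c0 /eqP s0].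
have cE : c = 3 / 4 * N 0 e0 by apply/eqP; rewrite -subr_eq0 c0.
have sE : s = 3 / 4 * N 0 e1 by apply/eqP; rewrite -subr_eq0 s0.
move: cs1 unit_coord_le1; rewrite cE sE !exprMn => *; lra.
Qed.

(** A complex tangent vector D killed by the splitting is a multiple of k. It is
    orthogonal to N, and k is not, so D = 0. *)
Lemma splitting_unit (J : 'M[R]_(m.+1, m.+2)) : row_free J -> J *m N^T = 0 ->
  map_mx (real_complex R) J *m splitting (c *: N) (s *: N) \in unitmx.
Proof.
move=> Jfree JN; rewrite -row_free_unit; apply: inj_row_free => w.
set D := w *m map_mx (real_complex R) J; rewrite mulmxA -/D => DQ0.
set t := (D *m isotropic) 0 0 / (k *m isotropic) 0 0.
have Dtk : D = t *: k.
  apply/eqP; rewrite -subr_eq0; set D' := D - _.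
  have DQ : D' = D *m (1%:M - ((k *m isotropic) 0 0)^-1 *: (isotropic *m k)).
    rewrite mulmxBr mulmx1 -scalemxAr mulmxA [D *m isotropic]mx11_scalar mul_scalar_mx.
    by rewrite scalerA mulrC.
  have D'S (j : 'I_m.+1) : D' 0 (lift ord0 j) = 0.
    have := congr1 (fun A : 'rV[C]_m.+1 => A 0 j) DQ0.
    rewrite DQ [RHS]mxE => <-; rewrite /splitting !mxE; apply: eq_bigr => a _.
    by rewrite !mxE.
  have D'l : (D' *m isotropic) 0 0 = 0.
    rewrite mulmxBl -scalemxAl mxE [X in _ + X]mxE [X in - X]mxE /t divfK ?subrr //.
    exact: transversal_isotropic_neq0.
  have D'0 : D' 0 e0 = 0.
    by move: D'l; rewrite mulmx_isotropic D'S mulr0 subr0.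
  apply/eqP/rowP => j; rewrite [RHS]mxE; case: (unliftP ord0 j) => [a ->|->] //.
have t0 : t = 0.
  have : (D *m map_mx (real_complex R) N^T) 0 0 = 0.
    by rewrite /D -mulmxA -map_mxM JN map_mx0 mulmx0 mxE.
  rewrite Dtk -scalemxAl mxE => /eqP; rewrite mulf_eq0.
  by rewrite (negPf transversal_normal_neq0) orbF => /eqP.
have D0 : D = 0 by rewrite Dtk t0 scale0r.
have : row_free (map_mx (real_complex R) J) by rewrite /row_free mxrank_map.
by move=> /row_free_inj; apply; rewrite -/D D0 mul0mx.
Qed.

End RotatedUnitVector.

Lemma continuous_at_splitting (T : topologicalType) (x : T)
    (u v : T -> 'rV[R]_m.+2) :
  (\forall y \near x, (transversal (u y) (v y) *m isotropic) 0 0 != 0) ->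
  {for x, continuous u} -> {for x, continuous v} ->
  {for x, continuous (fun y => splitting (u y) (v y))}.
Proof.
move=> k0 cu cv.
have ck : {for x, continuous (fun y => transversal (u y) (v y))}.
  apply: continuousB; last exact: cvg_cst.
  apply: mx_continuous_at => i j.
  rewrite (_ : (fun y => _) = fun y => (u y 0 j +i* v y 0 j)%C : C); last first.
    by apply/funext => y; rewrite mxE.
  by apply: continuous_at_complex; exact: continuous_at_entry.
have cE : {for x, continuous (fun y => 1%:M -
    ((transversal (u y) (v y) *m isotropic) 0 0)^-1 *:
                     (isotropic *m transversal (u y) (v y)))}.
  apply: continuousB; first exact: cvg_cst.
  apply: continuousZ.
    apply: continuousV; first exact: nbhs_singleton k0.
    apply: continuous_at_entry; apply: continuous_at_mulmx; first exact: ck.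
    exact: cvg_cst.
  by apply: continuous_at_mulmx; [exact: cvg_cst|exact: ck].
apply: mx_continuous_at => i j.
rewrite (_ : (fun y => _) = fun y => (1%:M -
    ((transversal (u y) (v y) *m isotropic) 0 0)^-1 *:
      (isotropic *m transversal (u y) (v y))) i (lift ord0 j)); last first.
  by apply/funext => y; rewrite /splitting [LHS]mxE.
exact: continuous_at_entry.
Qed.

End Splitting.

(** * The normal line of an immersion *)

Section CrossProduct.
Variables (F : fieldType) (n : nat).
Implicit Types (J : 'M[F]_(n, n.+1)) (v : 'rV[F]_n.+1).

(** The generalized cross product of the rows of J. The first row of the matrix
    is arbitrary, since the cofactors along it do not depend on it; thus the
    product of v and [cross J] is the determinant of v above J. *)
Definition cross J : 'rV[F]_n.+1 :=
  \row_j cofactor (col_mx (0 : 'rV[F]_n.+1) J : 'M[F]_n.+1) ord0 j.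

Lemma det_cross J v : v *m (cross J)^T = (\det (col_mx v J : 'M[F]_n.+1))%:M.
Proof.
apply/rowP => z; rewrite ord1 !mxE (expand_det_row _ ord0) /= mulr1n.
apply: eq_bigr => j _; rewrite !mxE; congr (_ * _).
  by case: splitP => // k _; rewrite ord1.
rewrite /cofactor; congr (_ * \det _); apply/matrixP => a b; rewrite !mxE.
by case: splitP => // i; rewrite ord1.
Qed.

Lemma mul_cross J : J *m (cross J)^T = 0.
Proof.
apply/row_matrixP => i; rewrite row_mul row0 det_cross.
rewrite (@determinant_alternate _ _ _ ord0 (lift ord0 i)) //; first exact: raddf0.
move=> j.
rewrite !mxE; case: splitP => k // _; case: splitP => l /= il.
  by case: l il => -[].
by rewrite mxE; congr (J _ j); apply/val_inj; case: il.
Qed.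

(** The n rows of J do not span the space, and a vector v outside their span
    completes them to a basis, so that det (v, J) is not 0. *)
Lemma cross_neq0 J : row_free J -> cross J != 0.
Proof.
move=> Jfree; apply/negP => /eqP J0.
have /row_subPn[k] : ~~ ((1%:M : 'M[F]_n.+1) <= J)%MS.
  by apply/negP => /mxrankS; rewrite mxrank1 (eqP Jfree) ltnn.
set v := row k _ => vJ.
have : v *m (cross J)^T = 0 by rewrite J0 trmx0 mulmx0.
rewrite det_cross => /(congr1 (fun A : 'M[F]_1 => A 0 0)); rewrite !mxE mulr1n.
apply/eqP; rewrite -unitfE -unitmxE -row_free_unit; apply: inj_row_free.
suff : forall w : 'rV[F]_(1 + n), w *m col_mx v J = 0 -> w = 0 by [].
move=> w; rewrite -[w]hsubmxK mul_row_col [lsubmx w]mx11_scalar mul_scalar_mx.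
set a := lsubmx w 0 0 => aJ; have a0 : a = 0.
  apply/eqP; apply: contraNT vJ => a0.
  have -> : v = - (a^-1 *: rsubmx w) *m J.
    rewrite mulNmx -scalemxAl; move/eqP: aJ; rewrite addrC addr_eq0 => /eqP ->.
    by rewrite scalerN opprK scalerA mulVf ?scale1r.
  exact: submxMl.
move: aJ; rewrite a0 scale0r add0r => Jw.
have -> : rsubmx w = 0 by apply: (row_free_inj Jfree); rewrite Jw mul0mx.
by rewrite raddf0 row_mx0.
Qed.

(** Through this determinant an orientation of the tangent spaces turns into an
    orientation of the normal lines. *)
Lemma cross_mul (T : 'M[F]_n) J : cross (T *m J) = \det T *: cross J.
Proof.
suff E : forall v, v *m (cross (T *m J))^T = v *m (\det T *: cross J)^T.
  by apply: trmx_inj; apply/row_matrixP => i; rewrite !rowE.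
move=> v; rewrite linearZ /= -scalemxAr !det_cross.
have -> : col_mx v (T *m J) = block_mx 1%:M 0 0 T *m col_mx v J.
  by rewrite mul_block_col mul1mx !mul0mx addr0 add0r.
have detT : \det (block_mx (1%:M : 'M[F]_1) 0 0 T) = \det T.
  by rewrite det_ublock det1 mul1r.
by rewrite det_mulmx detT scale_scalar_mx.
Qed.

End CrossProduct.

Lemma continuous_at_cross (K : numFieldType) (T : topologicalType) (x : T) n
    (J : T -> 'M[K]_(n, n.+1)) :
  {for x, continuous J} -> {for x, continuous (fun y => cross (J y))}.
Proof.
move=> cJ; apply: mx_continuous_at => i j.
rewrite (_ : (fun y => _) = fun y =>
    cofactor (col_mx (0 : 'rV[K]_n.+1) (J y) : 'M[K]_n.+1) ord0 j); last first.
  by apply/funext => y; rewrite mxE.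
apply: continuous_at_cofactor; apply: mx_continuous_at => a b.
rewrite (_ : (fun y => _) = fun y =>
    if fintype.split (a : 'I_(1 + n)) is inr a' then J y a' b else 0); last first.
  by apply/funext => y; rewrite mxE; case: (fintype.split _) => ?; rewrite ?mxE.
case: (fintype.split _) => [_|a']; first exact: cvg_cst.
exact: continuous_at_entry.
Qed.

Section UnitVector.
Variables (R : realType) (n : nat).
Implicit Types v : 'rV[R]_n.

Definition sqnorm v : R := \sum_j v 0 j ^+ 2.

Lemma mulmx_sqnorm v : v *m v^T = (sqnorm v)%:M.
Proof.
by apply/rowP => z; rewrite ord1 !mxE mulr1n; apply: eq_bigr => j _; rewrite mxE.
Qed.

Lemma sqnorm_gt0 v : v != 0 -> 0 < sqnorm v.
Proof.
move=> v0; rewrite lt_def sumr_ge0 ?andbT => [|j _]; last exact: sqr_ge0.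
apply: contra v0 => /eqP /psumr_eq0P s0; apply/eqP/rowP => j; rewrite mxE.
by apply/eqP; rewrite -sqrf_eq0 s0 // => i _; exact: sqr_ge0.
Qed.

Definition unit_vector v := (Num.sqrt (sqnorm v))^-1 *: v.

Lemma unit_vectorP v : v != 0 -> unit_vector v *m (unit_vector v)^T = 1%:M.
Proof.
move=> /sqnorm_gt0 v0.
rewrite /unit_vector linearZ /= -scalemxAr -scalemxAl scalerA mulmx_sqnorm.
by rewrite -invfM -expr2 sqr_sqrtr ?ltW // scale_scalar_mx mulVf ?gt_eqF.
Qed.

Lemma unit_vector_scale a v : unit_vector (a *: v) = Num.sg a *: unit_vector v.
Proof.
rewrite /unit_vector; have -> : sqnorm (a *: v) = a ^+ 2 * sqnorm v.
  by rewrite /sqnorm mulr_sumr; apply: eq_bigr => j _; rewrite mxE exprMn.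
rewrite sqrtrM ?sqr_ge0 // sqrtr_sqr invfM !scalerA; congr (_ *: _).
have [->|a0] := eqVneq a 0; first by rewrite sgr0 mulr0 mul0r.
rewrite mulrAC; congr (_ * _).
by rewrite {2}[a]realEsg ?num_real // mulrC mulfK ?normr_eq0.
Qed.

Lemma continuous_at_unit_vector (T : topologicalType) (x : T) (v : T -> 'rV[R]_n) :
  v x != 0 -> {for x, continuous v} ->
  {for x, continuous (fun y => unit_vector (v y))}.
Proof.
move=> v0 cv; apply: continuousZ => //.
apply: continuousV; first by rewrite gt_eqF // sqrtr_gt0 sqnorm_gt0.
have cs : {for x, continuous (fun y => sqnorm (v y))}.
  apply: continuous_at_sum => j _; rewrite /=.
  under [X in {for x, continuous X}]eq_fun do rewrite expr2.
  by apply: (@continuousM _ _ (fun y => v y 0 j) (fun y => v y 0 j)); exact: continuous_at_entry.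
apply: (continuous_comp cs); exact: sqrt_continuous.
Qed.

End UnitVector.


(** * Jacobians in overlapping charts *)

Lemma lin1_mx_diff (R : realType) n m (g : 'rV[R]_n -> 'rV[R]_m) p v :
  v *m 'J g p = 'd g p v.
Proof. exact: mul_rV_lin1. Qed.

Section ChangeOfChart.
Variables (R : realType) (n : nat) (M : topologicalType).
Variables (A B : smooth_atlas R n M) (a : chart_index A) (b : chart_index B).

Lemma chart_overlap_open :
  open (chart A a @` (chart_dom A a `&` chart_dom B b)).
Proof.
rewrite (_ : _ @` _ = (chart A a @` chart_dom A a) `&`
                      chart_inv A a @^-1` chart_dom B b); last first.
  apply/seteqP; split=> [_ [x [ax bx] <-]|_ [[x ax <-]] /=].
    by split; [exists x|rewrite /= chartK].
  by rewrite chartK // => bx; exists x.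
rewrite openE => y [ay bY] /=; apply: filterI.
  by apply: open_nbhs_nbhs; split=> //; exact: chart_img_open.
apply: chart_inv_continuous; first by rewrite inE.
by apply: open_nbhs_nbhs; split=> //; exact: chart_dom_open.
Qed.

(** The chain rule, with charts of two atlases since an orientation is given by
    an atlas that may differ from the one that defines the manifold. *)
Lemma jacobian_change m (F : M -> 'rV[R]_m) x :
  chart_dom A a x -> chart_dom B b x ->
  differentiable (F \o chart_inv A a) (chart A a x) ->
  differentiable (chart B b \o chart_inv A a) (chart A a x) ->
  differentiable (F \o chart_inv B b) (chart B b x) ->
  'J (F \o chart_inv A a) (chart A a x) =
  'J (chart B b \o chart_inv A a) (chart A a x) *m
  'J (F \o chart_inv B b) (chart B b x).
Proof.
move=> ax bx dFa dab dFb; apply/row_matrixP => k.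
rewrite !rowE mulmxA !lin1_mx_diff; set v := delta_mx _ _.
have xE : (chart B b \o chart_inv A a) (chart A a x) = chart B b x.
  by rewrite /= chartK.
have dFb' : differentiable (F \o chart_inv B b)
    ((chart B b \o chart_inv A a) (chart A a x)) by rewrite xE.
rewrite -xE.
transitivity ('D_v (F \o chart_inv A a) (chart A a x)).
  by apply/esym; exact: (deriveE v dFa).
transitivity ('D_v ((F \o chart_inv B b) \o (chart B b \o chart_inv A a))
    (chart A a x)).
  apply: near_eq_derive.
  have : nbhs (chart A a x) (chart A a @` (chart_dom A a `&` chart_dom B b)).
    by apply: open_nbhs_nbhs; split; [exact: chart_overlap_open|exists x].
  by apply: filterS => _ [y [ay bY] <-]; rewrite /= (chartK ay) (chartK bY).
transitivity (('d (F \o chart_inv B b) ((chart B b \o chart_inv A a) (chart A a x)) \o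
   'd (chart B b \o chart_inv A a) (chart A a x)) v); last by [].
rewrite -(diff_comp dab dFb').
exact: deriveE v (differentiable_comp dab dFb').
Qed.

End ChangeOfChart.

Lemma smooth_diff (R : realType) (V W : normedModType R) (U : set V) (g : V -> W) p :
  smooth U g -> U p -> differentiable g p.
Proof. by move=> /(_ 1) [+ _]; exact. Qed.

Lemma continuous_at_jacobian (R : realType) (n m : nat) (T : topologicalType)
    (U : set 'rV[R]_n) (g : 'rV[R]_n -> 'rV[R]_m) (phi : T -> 'rV[R]_n) (x : T) :
  smooth U g -> U (phi x) -> {for x, continuous phi} ->
  {for x, continuous (fun y => 'J g (phi y))}.
Proof.
move=> gs Ux cphi; apply: mx_continuous_at => i j.
rewrite (_ : (fun y => _) =
    fun y => (('d g (phi y)) (delta_mx 0 i)) 0 j); last first.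
  by apply/funext => y; rewrite mxE.
have [_ /(_ (delta_mx 0 i)) cd] := gs 1.
apply: (@continuous_at_entry _ _ _ _ _ (fun y => 'd g (phi y) (delta_mx 0 i))).
apply: (@continuous_comp _ _ _ phi (fun z => 'd g z (delta_mx 0 i))) => //.
by apply: cd; rewrite inE.
Qed.

Section ImmersedHypersurface.
Variables (R : realType) (n : nat) (M : smooth_manifold R n).
Variables (f : M -> 'rV[R]_n.+1) (f_immersion : immersion f).
Local Notation A := (atlas M).
Implicit Types (i j : chart_index A) (x : M).

Definition chart_jacobian i x : 'M[R]_(n, n.+1) :=
  'J (f \o chart_inv A i) (chart A i x).

Let f_diff i x : chart_dom A i x ->
  differentiable (f \o chart_inv A i) (chart A i x).
Proof.
by move=> ix; have [fs _] := f_immersion i; apply: (smooth_diff fs); exists x.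
Qed.

Lemma chart_jacobian_free i x : chart_dom A i x -> row_free (chart_jacobian i x).
Proof.
move=> ix; apply: inj_row_free => v; rewrite lin1_mx_diff => v0.
have [_ /(_ x ix) inj] := f_immersion i.
by apply: inj; rewrite v0 linear0.
Qed.

Lemma chart_jacobian_continuous i :
  {in chart_dom A i, continuous (chart_jacobian i)}.
Proof.
move=> x; rewrite inE => ix; have [fs _] := f_immersion i.
apply: (continuous_at_jacobian fs); first by exists x.
by apply: chart_continuous; rewrite inE.
Qed.

Lemma chart_jacobian_change i j x : chart_dom A i x -> chart_dom A j x ->
  chart_jacobian i x = 'J (transition i j) (chart A i x) *m chart_jacobian j x.
Proof.
move=> ix jx; apply: jacobian_change => //; try exact: f_diff.
by apply: (smooth_diff (@chart_smooth _ _ _ A i j)); exists x.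
Qed.

Definition normal_field (N : M -> 'rV[R]_n.+1) : Prop :=
  (forall x, N x *m (N x)^T = 1%:M) /\
  (forall i x, chart_dom A i x -> chart_jacobian i x *m (N x)^T = 0).

Lemma tangent_transition i j x : chart_dom A i x -> chart_dom A j x ->
  lin1_mx (@coord _ _ _ (tangent_bundle M) j x \o
           @vec _ _ _ (tangent_bundle M) i x) =
  'J (transition i j) (chart A i x).
Proof.
move=> ix jx; apply/matrixP => k l; rewrite !mxE /= /tangent_coord /=.
by rewrite /tangent_family_of asboolT.
Qed.

End ImmersedHypersurface.

(** The tangent vector with coordinates v in a chart is sent to v J Q, where J is
    the complexified Jacobian of f and Q the splitting given by (c + i s) N. The
    Jacobian of the transition from chart i to chart j relates the J of both
    charts, so the matrices J Q agree as maps on the tangent spaces. *)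
Lemma trivial_complexified_tangent (R : realType) (n : nat)
    (M : smooth_manifold R n) (f : M -> 'rV[R]_n.+1)
    (N : M -> 'rV[R]_n.+1) (c s : M -> R) :
  immersion f -> normal_field f N ->
  (forall x, c x ^+ 2 + s x ^+ 2 = 1) ->
  continuous (fun x => c x *: N x) -> continuous (fun x => s x *: N x) ->
  trivial_bundle (complexified_bundle (tangent_bundle M)).
Proof.
case: n M f N c s => [|m] M f N c s.
  move=> _ _ _ _ _.
  apply: (@trivial_bundle_of_frames _ _ _ _ (fun _ _ => 1%:M)) => [i x _|i x _|i j x _ _].
  - by rewrite unitmx1.
  - exact: cvg_cst.
  - by apply/matrixP => -[].
move=> fI [N1 JN] cs1 cc cS.
pose Q x := splitting (c x *: N x) (s x *: N x).
apply: (@trivial_bundle_of_frames _ _ _ (complexified_bundle (tangent_bundle M))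
  (fun (i : chart_index (atlas M)) x =>
   map_mx (real_complex R) (chart_jacobian f i x) *m Q x)) => /= [i x ix|i x|i j x ix jx].
- by apply: splitting_unit => //; [exact: chart_jacobian_free|exact: JN].
- rewrite inE => ix; apply: (@continuous_at_mulmx _ _ x _ _ _
    (fun y => map_mx (real_complex R) (chart_jacobian f i y)) Q).
    apply: mx_continuous_at => a b.
    rewrite (_ : (fun y => _) = real_complex R \o (fun y => chart_jacobian f i y a b)).
      apply: continuous_comp; last exact: real_complex_continuous.
      by apply: continuous_at_entry; apply: chart_jacobian_continuous => //; rewrite inE.
    by apply/funext => y; rewrite mxE.
  apply: continuous_at_splitting; [|exact: cc|exact: cS].
  by apply: nearW => y; exact: transversal_isotropic_neq0.
- rewrite mulmxA (complexified_transition (E := tangent_bundle M) j ix).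
  by rewrite (tangent_transition ix jx) -map_mxM -(chart_jacobian_change fI ix jx).
Qed.

(** * Normal fields *)
Section NormalFields.
Variables (R : realType) (n : nat) (M : smooth_manifold R n).
Variables (f : M -> 'rV[R]_n.+1) (f_immersion : immersion f).
Local Notation A := (atlas M).
Implicit Types (i j : chart_index A) (x : M).

Let nu i x := cross (chart_jacobian f i x).

Let nu_change i j x : chart_dom A i x -> chart_dom A j x ->
  nu i x = \det ('J (transition i j) (chart A i x)) *: nu j x.
Proof.
by move=> ix jx; rewrite /nu (chart_jacobian_change f_immersion ix jx) cross_mul.
Qed.

Let nu_neq0 i x : chart_dom A i x -> nu i x != 0.
Proof. by move=> ix; apply: cross_neq0; exact: chart_jacobian_free. Qed.

Let chart_jacobian_nu i j x : chart_dom A i x -> chart_dom A j x ->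
  chart_jacobian f i x *m (nu j x)^T = 0.
Proof.
move=> ix jx; rewrite (chart_jacobian_change f_immersion ix jx) -mulmxA.
by rewrite mul_cross mulmx0.
Qed.

Let nu_continuous i : {in chart_dom A i, continuous (nu i)}.
Proof.
by move=> x ix; apply: continuous_at_cross; exact: chart_jacobian_continuous.
Qed.

Let ic x : chart_index A := sval (cid (chart_cover A x)).
Let icP x : chart_dom A (ic x) x := svalP (cid (chart_cover A x)).

Let near_chart i x : chart_dom A i x -> \forall y \near x, chart_dom A i y.
Proof.
by move=> ix; apply: open_nbhs_nbhs; split => //; exact: chart_dom_open.
Qed.

(** N cannot be continuous in general, as it depends on a choice of chart at each
    point, but the orthogonal projection N^T N onto the normal line can: it is
    unchanged when N is replaced by - N. *)
Lemma exists_normal_line : exists N : M -> 'rV[R]_n.+1,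
  normal_field f N /\ continuous (fun x => (N x)^T *m N x).
Proof.
exists (fun x => unit_vector (nu (ic x) x)); split; first split => [x|i x ix].
- exact/unit_vectorP/nu_neq0.
- by rewrite /unit_vector linearZ /= -scalemxAr chart_jacobian_nu ?scaler0.
move=> x; have ix := icP x; set i := ic x in ix.
apply: (@near_eq_continuous_at _ _ _
  (fun y => (unit_vector (nu i y))^T *m unit_vector (nu i y))).
  apply: filterS (near_chart ix) => y iy.
  rewrite (nu_change iy (icP y)) unit_vector_scale.
  set d := \det _; have d0 : d != 0.
    apply: contra (nu_neq0 iy) => /eqP d0.
    by rewrite (nu_change iy (icP y)) -/d d0 scale0r.
  have a2 : Num.sg d * Num.sg d = 1 by rewrite -expr2 sqr_sg d0.
  by rewrite [X in X *m _]linearZ /= -scalemxAl -scalemxAr scalerA a2 scale1r.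
have cu : {for x, continuous (fun y => unit_vector (nu i y))}.
  by apply: continuous_at_unit_vector; [exact: nu_neq0|apply: nu_continuous; rewrite inE].
apply: (@continuous_at_mulmx _ _ x _ _ _ (fun y => (unit_vector (nu i y))^T)); last exact: cu.
exact: continuous_at_trmx.
Qed.

(** Cross products in the charts of an oriented atlas are positive multiples of
    each other, so they become equal once normalized. *)
Lemma exists_continuous_normal_field : orientable M ->
  exists N : M -> 'rV[R]_n.+1, normal_field f N /\ continuous N.
Proof.
move=> [B [AB oB]].
(* D b i x is the Jacobian of the transition from an oriented chart b to the chart i. *)
pose D b i x := 'J (chart A i \o chart_inv B b) (chart B b x).
have dAB i b x : chart_dom A i x -> chart_dom B b x ->
    differentiable (chart B b \o chart_inv A i) (chart A i x).
  by move=> ix bx; have [sm _] := AB i b; apply: (smooth_diff sm); exists x.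
have dBA i b x : chart_dom A i x -> chart_dom B b x ->
    differentiable (chart A i \o chart_inv B b) (chart B b x).
  by move=> ix bx; have [_ sm] := AB i b; apply: (smooth_diff sm); exists x.
have dA i j x : chart_dom A i x -> chart_dom A j x ->
    differentiable (chart A j \o chart_inv A i) (chart A i x).
  by move=> ix jx; apply: (smooth_diff (@chart_smooth _ _ _ A i j)); exists x.
have dB b c x : chart_dom B b x -> chart_dom B c x ->
    differentiable (chart B c \o chart_inv B b) (chart B b x).
  by move=> bx cx; apply: (smooth_diff (@chart_smooth _ _ _ B b c)); exists x.
(* The product of D b i with the Jacobian of the inverse transition is the Jacobian
   of the transition from b to b, whose determinant is positive. *)
have D0 b i x : chart_dom A i x -> chart_dom B b x -> \det (D b i x) != 0.
  move=> ix bx; have := oB b b x bx bx; rewrite /transition.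
  rewrite (@jacobian_change _ _ _ B A b i) //; [|exact: dB|exact: dBA|exact: dAB].
  rewrite det_mulmx => /gt_eqF/negbT; rewrite mulf_eq0 negb_or => /andP[Dbi _].
  exact: Dbi.
(* By the chain rule this is the cross product of the Jacobian of f in the oriented
   chart b: it does not depend on i, and depends on b up to a positive factor. *)
pose mu b i x := \det (D b i x) *: nu i x.
have det_chain (T1 T2 T : 'M[R]_n) (v w : 'rV[R]_n.+1) :
    T2 = T1 *m T -> v = \det T *: w -> \det T1 *: v = \det T2 *: w.
  by move=> -> ->; rewrite scalerA det_mulmx.
have mu_i b i j x : chart_dom A i x -> chart_dom A j x -> chart_dom B b x ->
    mu b i x = mu b j x.
  move=> ix jx bx.
  exact: (det_chain _ _ _ _ _ (jacobian_change bx ix (dBA _ _ _ jx bx)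
    (dBA _ _ _ ix bx) (dA _ _ _ ix jx)) (nu_change ix jx)).
have unit_chain (T1 T2 T : 'M[R]_n) (v : 'rV[R]_n.+1) : T1 = T *m T2 ->
    0 < \det T -> unit_vector (\det T1 *: v) = unit_vector (\det T2 *: v).
  move=> -> T0; rewrite det_mulmx -scalerA unit_vector_scale gtr0_sg //.
  exact: scale1r.
have mu_b b c i x : chart_dom A i x -> chart_dom B b x -> chart_dom B c x ->
    unit_vector (mu b i x) = unit_vector (mu c i x).
  move=> ix bx cx.
  exact: (unit_chain _ _ _ _ (jacobian_change bx cx (dBA _ _ _ ix bx)
    (dB _ _ _ bx cx) (dBA _ _ _ ix cx)) (oB b c x bx cx)).
pose bc x : chart_index B := sval (cid (chart_cover B x)).
have bcP x : chart_dom B (bc x) x := svalP (cid (chart_cover B x)).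
have mu0 b i x : chart_dom A i x -> chart_dom B b x -> mu b i x != 0.
  move=> ix bx; rewrite scaler_eq0 negb_or; apply/andP; split; first exact: D0.
  exact: nu_neq0.
exists (fun x => unit_vector (mu (bc x) (ic x) x)); split; first split => [x|i x ix].
- exact: unit_vectorP (mu0 _ _ _ (icP x) (bcP x)).
- by rewrite /unit_vector /mu scalerA linearZ /= -scalemxAr chart_jacobian_nu ?scaler0.
move=> x; have ix := icP x; set i := ic x in ix.
have bx := bcP x; set b := bc x in bx.
apply: (@near_eq_continuous_at _ _ _ (fun y => unit_vector (mu b i y))).
  have by_ : \forall y \near x, chart_dom B b y.
    by apply: open_nbhs_nbhs; split => //; exact: chart_dom_open.
  apply: filterS2 (near_chart ix) by_ => y iy by_.
  by rewrite (mu_i _ _ _ _ iy (icP y) by_); exact: mu_b (icP y) by_ (bcP y).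
apply: continuous_at_unit_vector; first exact: mu0.
apply: continuousZ; last by apply: nu_continuous; rewrite inE.
apply: continuous_at_det; have [_ sm] := AB i b.
apply: (continuous_at_jacobian sm); first by exists x.
by apply: chart_continuous; rewrite inE.
Qed.

End NormalFields.

(** * Simplices *)

(** Compactness transfers from a subset to the type of its points, which is the
    domain of singular simplices. *)
Lemma compact_set_type (X : topologicalType) (A : set X) :
  compact A -> compact [set: A].
Proof.
move=> /compact_near_coveringP cA; apply/compact_near_coveringP => I F P FF Pnear.
suff : \forall i \near F, A `<=` (fun v => forall t : A, set_val t = v -> P i t).
  apply: filterS => i Pi t _; apply: (Pi (set_val t)) => //; exact: set_valP.
apply: cA => v Av; have /= := Pnear (exist _ v (mem_set Av)) Logic.I.
case=> -[U W] /= [[B [[C oC CB] Bv] BU] FW] UW.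
exists (C, W) => /=.
  by split=> //; apply: open_nbhs_nbhs; split=> //; move: Bv; rewrite -CB.
move=> [v' i] /= [Cv' Wi] t tv'; apply: (UW (t, i)); split => //=.
by apply: BU; rewrite -CB /preimage /= tv'.
Qed.

Section SimplexTopology.
Variables (R : realType) (k : nat).
Local Notation simplex := (std_simplex R k).

Lemma compact_std_simplex : compact simplex.
Proof.
have -> : simplex = [set v : 'rV[R]_k.+1 | forall i, `[0, 1]%classic (v ord0 i)] `&`
    [set v | \sum_i v 0 i = 1].
  apply/seteqP; split=> v [v0 v1]; split=> // i.
    rewrite /= in_itv /= v0 -v1 (bigD1 i) //= lerDl.
    by apply: sumr_ge0 => j _.
  by have := v0 i; rewrite /= in_itv /= => /andP[].
apply: compact_closedI.
  apply: (@rV_compact R k.+1 (fun=> `[0, 1]%classic)) => i.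
  exact: segment_compact.
apply: (@closed_comp _ _ (fun v : 'rV[R]_k.+1 => \sum_i v 0 i) [set 1]).
  move=> v _; apply: continuous_at_sum => i _; exact: coord_continuous.
exact: closed_eq.
Qed.

Definition clamp (s : R) : R := Num.max 0 (Num.min 1 s).

Lemma clamp_ge0 s : 0 <= clamp s. Proof. by rewrite le_max lexx. Qed.

Lemma clamp_le1 s : clamp s <= 1.
Proof. by rewrite ge_max ler01 ge_min lexx. Qed.

Lemma clamp0 : clamp 0 = 0.
Proof. by rewrite /clamp (min_idPr ler01) maxxx. Qed.

Lemma clamp1 : clamp 1 = 1.
Proof. by rewrite /clamp minxx (max_idPr ler01). Qed.

Lemma clamp_continuous : continuous clamp.
Proof.
move=> s; have c0 (a : R) : {for s, continuous (cst a : R -> R^o)} by exact: cvg_cst.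
have cid_ : {for s, continuous (id : R -> R^o)} by exact: cvg_id.
exact: (continuous_max (c0 0) (continuous_min (c0 1) cid_)).
Qed.

Lemma simplex_convex (a : R) (t t' : simplex) : 0 <= a <= 1 ->
  (1 - a) *: val t + a *: val t' \in simplex.
Proof.
case: t t' => t /=; rewrite inE => -[t0 t1] [t' /=]; rewrite !inE => -[t'0 t'1].
move=> /andP[a0 a1]; split=> [i|].
  by rewrite !mxE addr_ge0 // mulr_ge0 // subr_ge0.
under eq_bigr do rewrite !mxE.
by rewrite big_split /= -!mulr_sumr t1 t'1 !mulr1 subrK.
Qed.

(** The contraction of the simplex onto t0. The parameter is clamped to [0, 1], so
    that s may range over the real line, which is connected. *)
Definition slide (t0 : simplex) (s : R) (t : simplex) : simplex :=
  exist _ ((1 - clamp s) *: val t0 + clamp s *: val t)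
    (simplex_convex t0 t (introT andP (conj (clamp_ge0 s) (clamp_le1 s)))).

Lemma slide0 t0 t : slide t0 0 t = t0.
Proof. by apply/val_inj; rewrite /= clamp0 subr0 scale1r scale0r addr0. Qed.

Lemma slide1 t0 t : slide t0 1 t = t.
Proof. by apply/val_inj; rewrite /= clamp1 subrr scale0r scale1r add0r. Qed.

Lemma slide_continuous t0 : continuous (fun p : R * simplex => slide t0 p.1 p.2).
Proof.
apply: continuous_comp_initial => -[s t].
have cs : {for (s, t), continuous (fun p : R * simplex => clamp p.1)}.
  by apply: (@continuous_comp _ _ _ fst clamp); [exact: cvg_fst|exact: clamp_continuous].
have cv : {for (s, t), continuous (fun p : R * simplex => val p.2)}.
  apply: (@continuous_comp _ _ _ snd (val : simplex -> 'rV[R]_k.+1)).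
    exact: cvg_snd.
  exact: initial_continuous.
have c1 : {for (s, t), continuous (fun p : R * simplex => 1 - clamp p.1)}.
  by apply: continuousB; [exact: cvg_cst|exact: cs].
exact: (continuousD (continuousZ c1 (cvg_cst (val t0))) (continuousZ cs cv)).
Qed.

Lemma vertex_in (i : 'I_k.+1) : (delta_mx 0 i : 'rV[R]_k.+1) \in simplex.
Proof.
rewrite inE; split=> [j|]; first by rewrite mxE ler0n.
rewrite (bigD1 i) //= mxE !eqxx big1 ?addr0 // => j /negPf ji.
by rewrite mxE ji andbF.
Qed.

Definition vertex i : simplex :=
  exist _ (delta_mx 0 i : 'rV[R]_k.+1) (vertex_in i).

End SimplexTopology.

Arguments vertex {R k}.

Lemma face_vertex (R : realType) k (j : 'I_k.+2) (i : 'I_k.+1) :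
  face j (vertex i : std_simplex R k) = vertex (lift j i).
Proof.
apply/val_inj/rowP => a; rewrite /= !mxE.
case: unliftP => [b ->|->]; last by rewrite (negPf (neq_lift _ _)) andbF.
by rewrite mxE (inj_eq lift_inj).
Qed.

(** * Sign changes of a line field along singular simplices *)

(** Continuation along [0, 1], in the form used both for the existence of sections
    along a simplex and for the constancy of their signs. *)
Lemma clopen_line (R : realType) (S : set R) : open S -> closed S -> S 0 -> S 1.
Proof.
move=> oS cS S0; have cT : connected [set: R] by apply/connected_intervalP.
have -> // : S = setT.
by apply: cT; [exists 0|exists S => //; rewrite setTI|exists S => //; rewrite setTI].
Qed.

Section LineField.
Variables (R : realType) (M : topologicalType) (d : nat).
Variable N : M -> 'rV[R]_d.
Hypothesis N_unit : forall x, N x *m (N x)^T = 1%:M.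
Hypothesis N_line : continuous (fun x => (N x)^T *m N x).

(** Only the square of this number is continuous in x and y, since N is continuous
    only up to sign; it does not vanish when x and y have the same line. *)
Definition dot x y : R := (N x *m (N y)^T) 0 0.

Lemma dotxx x : dot x x = 1.
Proof. by rewrite /dot N_unit mxE. Qed.

Lemma dotC x y : dot x y = dot y x.
Proof. by rewrite /dot -[N x in LHS]trmxK -trmx_mul mxE. Qed.

Lemma mulmx_proj x y : N x *m ((N y)^T *m N y) = dot x y *: N y.
Proof. by rewrite mulmxA [_ *m (N y)^T]mx11_scalar mul_scalar_mx. Qed.

(** The square is expressed by the projections onto the two lines, which are
    continuous. *)
Lemma dot_sqr x y : dot x y ^+ 2 = \tr ((N x)^T *m N x *m ((N y)^T *m N y)).
Proof.
rewrite -mulmxA mulmx_proj -scalemxAr linearZ /= mxtrace_mulC /mxtrace.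
by rewrite big_ord_recl big_ord0 addr0 -/(dot y x) dotC expr2.
Qed.

Lemma continuous_at_proj (T : topologicalType) (g : T -> M) t :
  {for t, continuous g} ->
  {for t, continuous (fun u => (N (g u))^T *m N (g u))}.
Proof.
move=> cg; apply: (@continuous_comp _ _ _ g (fun x => (N x)^T *m N x)).
  exact: cg.
exact: N_line.
Qed.

Lemma continuous_at_dot_sqr (T : topologicalType) (g h : T -> M) t :
  {for t, continuous g} -> {for t, continuous h} ->
  {for t, continuous (fun u => dot (g u) (h u) ^+ 2)}.
Proof.
move=> cg ch.
rewrite (_ : (fun u => _) = fun u => \sum_i
    ((N (g u))^T *m N (g u) *m ((N (h u))^T *m N (h u))) i i); last first.
  by apply/funext => u; rewrite dot_sqr.
apply: continuous_at_sum => i _; apply: continuous_at_entry.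
apply: (@continuous_at_mulmx _ _ t _ _ _ (fun u => (N (g u))^T *m N (g u))).
  exact: continuous_at_proj.
exact: continuous_at_proj.
Qed.

(** A continuous nonvanishing section c N of the line field along g. The sign of
    c t compares it with the reference vector N (g t); c need not be
    continuous. *)
Definition section_along (T : topologicalType) (g : T -> M) (c : T -> R) : Prop :=
  (forall t, c t != 0) /\ continuous (fun t => c t *: N (g t)).

(** Nearby lines are not orthogonal, so the orthogonal projection of the lines along
    g onto the lines along h transports nonvanishing sections. *)
Lemma section_along_near (T : topologicalType) (g h : T -> M) (c : T -> R) :
  continuous h -> (forall t, dot (g t) (h t) != 0) -> section_along g c ->
  section_along h (fun t => c t * dot (g t) (h t)).
Proof.
move=> ch gh0 [c0 cc]; split=> [t|t]; first by rewrite mulf_neq0.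
rewrite (_ : (fun u => _) = fun u => (c u *: N (g u)) *m ((N (h u))^T *m N (h u)));
  last first.
  by apply/funext => u; rewrite -scalemxAl mulmx_proj scalerA.
apply: (@continuous_at_mulmx _ _ t _ _ _ (fun u => c u *: N (g u))); first exact: cc.
by apply: continuous_at_proj; exact: ch.
Qed.

Lemma section_along_comp (T U : topologicalType) (g : T -> M) (phi : U -> T) c :
  continuous phi -> section_along g c -> section_along (g \o phi) (c \o phi).
Proof.
move=> cphi [c0 cc]; split=> [u|u]; first exact: c0.
exact: (@continuous_comp _ _ _ phi (fun t => c t *: N (g t)) u (cphi u) (cc _)).
Qed.

Section OnSimplex.
Variable k : nat.
Local Notation simplex := (std_simplex R k).

(** Contract the simplex onto a vertex. The parameters s for which there is a section
    along the contracted simplex form an open and closed set: by compactness of the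
    simplex, the lines at parameters s and s' are nowhere orthogonal for s' near s,
    and then [section_along_near] applies both ways. At s = 0 the simplex is
    constant. *)
Lemma section_along_simplex (g : simplex -> M) : continuous g ->
  exists c, section_along g c.
Proof.
move=> cg; pose v0 : simplex := vertex ord0.
pose h s t := g (slide v0 s t).
have ch2 : continuous (fun p : R * simplex => h p.1 p.2).
  move=> p; apply: (@continuous_comp _ _ _ (fun p => slide v0 p.1 p.2) g).
    exact: slide_continuous.
  exact: cg.
have ch s : continuous (h s).
  move=> t; apply: (@continuous_comp _ _ _ (fun t => (s, t)) (fun p => h p.1 p.2)).
    apply: (@continuous_at_pair _ _ _ (fun=> s) id t); last exact: cvg_id.
    exact: cst_continuous.
  exact: ch2.
pose S := [set s | exists c, section_along (h s) c].
have near_dot s : \forall s' \near s, forall t, dot (h s t) (h s' t) != 0.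
  have /compact_near_coveringP K := compact_set_type (@compact_std_simplex R k).
  have := K R (nbhs s) (fun s' t => dot (h s t) (h s' t) != 0) _.
  have Hs : forall t : simplex, [set: simplex] t ->
     \forall t' \near t & s' \near s, dot (h s t') (h s' t') != 0.
    move=> t _.
    have cD : {for (t, s), continuous (fun p : simplex * R =>
        dot (h s p.1) (h p.2 p.1) ^+ 2)}.
      apply: continuous_at_dot_sqr.
        apply: (@continuous_comp _ _ _ fst (h s)); first exact: cvg_fst.
        exact: ch.
      apply: (@continuous_comp _ _ _ (fun p : simplex * R => (p.2, p.1))
        (fun p => h p.1 p.2)); last exact: ch2.
      by apply: continuous_at_pair; [exact: cvg_snd|exact: cvg_fst].
    have : \forall p \near (t, s), 0 < dot (h s p.1) (h p.2 p.1) ^+ 2.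
      by apply: (cvgr_gt _ cD); rewrite /= dotxx expr1n.
    by apply: filterS => p; rewrite lt_def sqrf_eq0 => /andP[].
  move=> /(_ _ Hs); apply: filterS => s' H t; exact: H.
suff [c Sc] : S 1.
  exists c; have -> // : g = h 1.
  by apply/funext => t; rewrite /h slide1.
apply: clopen_line.
- rewrite openE => s [c sc]; apply: filterS (near_dot s) => s' ss'.
  by exists (fun t => c t * dot (h s t) (h s' t)); exact: section_along_near.
- move=> s cls; have [s' [[c s'c] ss']] := cls _ (near_dot s).
  exists (fun t => c t * dot (h s' t) (h s t)); apply: section_along_near => // t.
  by rewrite dotC.
- exists (fun=> 1); split=> [t|t]; first exact: oner_neq0.
  rewrite (_ : (fun u => _) = fun u => 1 *: N (g v0)); first exact: cst_continuous.
  by apply/funext => u; rewrite /h slide0.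
Qed.

Lemma nonvanishing_same_sign (e : simplex -> R) t t' : continuous e ->
  (forall t, e t != 0) -> 0 < e t * e t'.
Proof.
move=> ce e0; pose S := [set s | 0 < e t * e (slide t s t')].
have cS : continuous (fun s => e t * e (slide t s t')).
  move=> s; apply: continuousM; first exact: cst_continuous.
  apply: (@continuous_comp _ _ _ (fun s => (s, t')) (fun p => e (slide t p.1 p.2))).
    by apply: continuous_at_pair; [exact: cvg_id|exact: cst_continuous].
  apply: (@continuous_comp _ _ _ (fun p : R * simplex => slide t p.1 p.2) e); last exact: ce.
  exact: slide_continuous.
have SE : S = [set s | 0 <= e t * e (slide t s t')].
  by apply/seteqP; split=> s /=; rewrite /S /= lt_def mulf_neq0.
have : S 1; last by rewrite /S /= slide1.
apply: clopen_line.
- apply: (@open_comp _ _ (fun s => e t * e (slide t s t')) [set x | 0 < x]).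
    by move=> s _; exact: cS.
  exact: open_gt.
- rewrite SE.
  apply: (@closed_comp _ _ (fun s => e t * e (slide t s t')) [set x | 0 <= x]).
    by move=> s _; exact: cS.
  exact: closed_ge.
- by rewrite /S /= slide0 -expr2 lt_def sqr_ge0 sqrf_eq0 e0.
Qed.

(** The product of two sections c N and c' N is the function c c', continuous and
    nonvanishing on a connected space, hence of constant sign. *)
Lemma section_along_sign (g : simplex -> M) c c' t t' :
  section_along g c -> section_along g c' ->
  (c t * c t' < 0) = (c' t * c' t' < 0).
Proof.
move=> [c0 cc] [c'0 cc'].
have : 0 < (c t * c' t) * (c t' * c' t').
  apply: (nonvanishing_same_sign (e := fun u => c u * c' u)) => [u|u]; last first.
    by rewrite mulf_neq0.
  rewrite (_ : (fun u => _) = fun u => ((c u *: N (g u)) *m (c' u *: N (g u))^T) 0 0).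
    apply: (@continuous_at_entry _ _ u _ _
      (fun u => (c u *: N (g u)) *m (c' u *: N (g u))^T)).
    apply: (@continuous_at_mulmx _ _ u _ _ _ (fun u => c u *: N (g u))); first exact: cc.
    by apply: continuous_at_trmx; exact: cc'.
  apply/funext => w; rewrite [(_ *: _)^T]linearZ /= -scalemxAl -scalemxAr N_unit scalerA.
  by rewrite !mxE mulr1.
rewrite mulrACA => pos.
have [neg|ps] := ltP (c t * c t') 0.
  by move: pos; rewrite nmulr_rgt0.
apply/esym/negbTE; rewrite -leNgt ltW //.
by rewrite -(pmulr_rgt0 _ (_ : 0 < c t * c t')) // lt_def ps mulf_neq0.
Qed.

End OnSimplex.

End LineField.

(** * The Bockstein cocycle *)

Section Bockstein.
Variables (R : realType) (M : topologicalType) (d : nat).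
Variable N : M -> 'rV[R]_d.
Hypothesis N_unit : forall x, N x *m (N x)^T = 1%:M.
Hypothesis N_line : continuous (fun x => (N x)^T *m N x).

(** Whether transport along g carries N at the start of g to a negative multiple of
    N at its end. *)
Definition flip (g : singular_simplex R 1 M) : bool :=
  `[< exists c, section_along N g c /\
        c (vertex (inord 0)) * c (vertex (inord 1)) < 0 >].

Lemma flipE (g : singular_simplex R 1 M) c : section_along N g c ->
  flip g = (c (vertex (inord 0)) * c (vertex (inord 1)) < 0).
Proof.
move=> gc; apply/asboolP/idP => [[c' [gc' neg]]|neg]; last by exists c.
by rewrite (section_along_sign N_unit _ _ gc gc').
Qed.

(* Vertices are numbered by natural numbers, so that the faces of faces compute. *)
Let sign k (c : std_simplex R k -> R) (m : nat) : bool := c (vertex (inord m)) < 0.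

Let sign_face k (c : std_simplex R k.+1 -> R) (j : 'I_k.+2) m : (m < k.+1)%N ->
  sign (c \o face j) m = sign c (bump j m).
Proof.
move=> mk; rewrite /sign /= face_vertex; congr (c (vertex _) < 0).
have bk : (bump j m < k.+2)%N by rewrite /bump; case: (j <= m)%N => //; exact: ltnW.
by apply/val_inj; rewrite /= !inordK.
Qed.

Lemma flip_face (s : singular_simplex R 2 M) c j : section_along N s c ->
  flip (s \o face j) = sign c (bump j 0) (+) sign c (bump j 1).
Proof.
move=> sc; have fc : section_along N (s \o face j) (c \o face j).
  by apply: section_along_comp => //; exact: cts_fun.
rewrite (flipE fc) -!sign_face //.
by have [c0 _] := fc; rewrite mulr_lt0 !c0.
Qed.

Definition flip_cochain : cochain R M 1 := fun g => (flip g : nat)%:Z.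

(** With the signs of a section at the three vertices, [flip] of an edge is the sum
    modulo 2 of the signs at its ends. The alternating sum of the three values is 2
    if the sign at the middle vertex differs from the two others, and 0
    otherwise. *)
Lemma coboundary_flip (s : singular_simplex R 2 M) c : section_along N s c ->
  coboundary flip_cochain s = 2 * ((sign c 0 (+) sign c 1) && (sign c 1 (+) sign c 2) : nat)%:Z.
Proof.
move=> sc; rewrite /coboundary !big_ord_recl big_ord0 /flip_cochain !(flip_face _ sc) /=.
rewrite /bump /=.
by case: (sign c 0) (sign c 1) (sign c 2) => [] [] [].
Qed.

Definition bockstein : cochain R M 2 := fun s => (coboundary flip_cochain s %/ 2)%Z.

Lemma bocksteinE (s : singular_simplex R 2 M) c : section_along N s c ->
  bockstein s = ((sign c 0 (+) sign c 1) && (sign c 1 (+) sign c 2) : nat)%:Z.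
Proof. by move=> /coboundary_flip; rewrite /bockstein => ->; rewrite mulKz. Qed.

(** Both the cochain and its coboundary are functions of the signs at the vertices of
    one section along the whole 3-simplex, so that the identity is a matter of
    checking the sixteen possible cases. *)
Lemma bockstein_cocycle : cocycle bockstein.
Proof.
move=> s; have [c sc] := section_along_simplex N_unit N_line (@cts_fun _ _ s).
have fc j : section_along N (s \o face j) (c \o face j).
  by apply: section_along_comp => //; exact: cts_fun.
rewrite /coboundary !big_ord_recl big_ord0 !(bocksteinE (fc _)) !sign_face //= /bump /=.
by case: (sign c 0) (sign c 1) (sign c 2) (sign c 3) => [] [] [] [].
Qed.

Lemma double_bockstein s : coboundary flip_cochain s = 2 * bockstein s.
Proof.
have [c sc] := section_along_simplex N_unit N_line (@cts_fun _ _ s).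
by rewrite (coboundary_flip sc) (bocksteinE sc).
Qed.

(** If the Bockstein of w is the coboundary of b, then w - 2b is a cocycle. *)
Lemma exists_integral_lift : singular_cohomology_vanishes R M 2 ->
  exists W : cochain R M 1, cocycle W /\
    forall g, exists b : int, W g = (flip g : nat)%:Z + 2 * b.
Proof.
move=> /(_ _ bockstein_cocycle) [b bE].
exists (fun g => flip_cochain g - 2 * b g); split=> [s|g]; last first.
  by exists (- b g); rewrite mulrN.
have : coboundary flip_cochain s - 2 * coboundary b s = 0.
  by rewrite double_bockstein -bE subrr.
move=> <-; rewrite /coboundary mulr_sumr -sumrB; apply: eq_bigr => j _.
by rewrite mulrBr mulrCA.
Qed.

End Bockstein.

(** * Integral cocycles on convex cells *)

Section SimplexCoordinates.
Variables (R : realType) (k : nat).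
Local Notation simplex := (std_simplex R k).

(** Barycentric coordinates, indexed by natural numbers so that the indices of faces
    compute. *)
Definition bary (m : nat) (t : simplex) : R := val t 0 (inord m).

Lemma bary_continuous m : continuous (bary m).
Proof.
move=> t; apply: (@continuous_comp _ _ _ (val : simplex -> 'rV[R]_k.+1)
  (fun v : 'rV[R]_k.+1 => v 0 (inord m))); first exact: initial_continuous.
exact: coord_continuous.
Qed.

Lemma bary_ge0 m t : 0 <= bary m t.
Proof. by have := set_valP t; move=> [+ _]; exact. Qed.

Lemma sum_bary t : \sum_(m < k.+1) bary m t = 1.
Proof.
have [_ <-] := set_valP t; apply: eq_bigr => m _.
by rewrite /bary inord_val.
Qed.

End SimplexCoordinates.

Lemma bary_face (R : realType) k (j : 'I_k.+2) (t : std_simplex R k) m :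
  (m < k.+1)%N -> bary (bump j m) (face j t) = bary m t.
Proof.
move=> mk; have -> : bump j m = lift j (inord m : 'I_k.+1) :> nat.
  by rewrite /= inordK.
by rewrite /bary inord_val mxE liftK.
Qed.

Lemma bary_face0 (R : realType) k (j : 'I_k.+2) (t : std_simplex R k) :
  bary j (face j t) = 0.
Proof. by rewrite /bary inord_val mxE unlift_none. Qed.

Lemma bary1 (R : realType) (t : std_simplex R 1) : bary 0 t + bary 1 t = 1.
Proof. by rewrite -[RHS](sum_bary t) !big_ord_recl big_ord0 addr0. Qed.

Lemma bary2 (R : realType) (t : std_simplex R 2) :
  bary 0 t + bary 1 t + bary 2 t = 1.
Proof. by rewrite -[RHS](sum_bary t) !big_ord_recl big_ord0 addr0 addrA. Qed.

Lemma bary_vertex (R : realType) k (m l : nat) : (m <= k)%N -> (l <= k)%N ->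
  bary m (vertex (inord l) : std_simplex R k) = (m == l)%:R.
Proof.
move=> mk lk; rewrite /bary /= mxE eqxx /=; congr (_%:R).
by rewrite -val_eqE /= !inordK.
Qed.

Section SimplexOf.
Variables (R : realType) (M : topologicalType) (k : nat).

(** The singular simplex with underlying map a if a is continuous, and a constant one
    otherwise; with this totalization segments between arbitrary points can be
    written down before they are known to lie in a cell. *)
Definition simplex_of (a : std_simplex R k -> M) : singular_simplex R k M :=
  match pselect (continuous a) with
  | left ca => mkcts ca
  | right _ => mkcts (@cst_continuous _ _ (a (vertex ord0)))
  end.

Lemma simplex_ofE a : continuous a -> simplex_of a =1 a.
Proof. by move=> ca t; rewrite /simplex_of; case: pselect. Qed.

End SimplexOf.

Section Cocycle.
Variables (R : realType) (M : topologicalType) (W : cochain R M 1).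
Hypothesis W_cocycle : cocycle W.

Lemma cocycle_triangle (a : std_simplex R 2 -> M) (g0 g1 g2 : singular_simplex R 1 M) :
  continuous a ->
  (forall t, g0 t = a (face (inord 0) t)) ->
  (forall t, g1 t = a (face (inord 1) t)) ->
  (forall t, g2 t = a (face (inord 2) t)) -> W g1 = W g2 + W g0.
Proof.
move=> ca e0 e1 e2; have := W_cocycle (simplex_of a).
have E (g : singular_simplex R 1 M) (j : 'I_3) : (forall t, g t = a (face j t)) ->
    simplex_of a \o face j = g :> singular_simplex R 1 M.
  by move=> gE; apply/continuousEP => t; rewrite gE -(simplex_ofE ca).
rewrite /coboundary !big_ord_recl big_ord0 addr0 /=.
rewrite (E g0 ord0) ?(E g1 (lift ord0 ord0)) ?(E g2 (lift ord0 (lift ord0 ord0))).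
- move=> sum0; apply/eqP; rewrite -subr_eq0 -[X in _ == X]oppr0 -sum0 /bump /=.
  by apply/eqP; ring.
- move=> t; rewrite e2; congr (a (face _ _)); apply/val_inj; by rewrite /= inordK.
- move=> t; rewrite e1; congr (a (face _ _)); apply/val_inj; by rewrite /= inordK.
- move=> t; rewrite e0; congr (a (face _ _)); apply/val_inj; by rewrite /= inordK.
Qed.

(** The three faces of the constant 2-simplex are all equal to g. *)
Lemma cocycle_cst (g : singular_simplex R 1 M) x : (forall t, g t = x) -> W g = 0.
Proof.
move=> gx; have := @cocycle_triangle (fun=> x) g g g (@cst_continuous _ _ x) gx gx gx.
by move/eqP; rewrite -subr_eq0 opprD addNKr oppr_eq0 => /eqP.
Qed.

End Cocycle.

(** An open set of M presented as a retract of a convex set of R^n, such as a ball in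
    the image of a chart. Convexity is stated for three points, which covers segments
    and triangles at once. *)
Record convex_cell (R : realType) (n : nat) (M : topologicalType) := ConvexCell {
  cell_set : set M;
  cell_image : set 'rV[R]_n;
  cell_coord : M -> 'rV[R]_n;
  cell_point : 'rV[R]_n -> M;
  cell_coord_in : forall x, cell_set x -> cell_image (cell_coord x);
  cell_point_in : forall v, cell_image v -> cell_set (cell_point v);
  cell_coordK : forall x, cell_set x -> cell_point (cell_coord x) = x;
  cell_open : open cell_set;
  cell_coord_continuous : {in cell_set, continuous cell_coord};
  cell_point_continuous : {in cell_image, continuous cell_point};
  cell_convex : forall (a b c : R) u v w, 0 <= a -> 0 <= b -> 0 <= c ->
    a + b + c = 1 -> cell_image u -> cell_image v -> cell_image w ->
    cell_image (a *: u + b *: v + c *: w) }.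

Section Segments.
Variables (R : realType) (n : nat) (M : topologicalType) (G : convex_cell R n M).
Local Notation phi := (cell_coord G).
Local Notation psi := (cell_point G).

Lemma cell_convex2 (a b : R) u v : 0 <= a -> 0 <= b -> a + b = 1 ->
  cell_image G u -> cell_image G v -> cell_image G (a *: u + b *: v).
Proof.
move=> a0 b0 ab1 Gu Gv; have := @cell_convex _ _ _ G a b 0 u v v a0 b0 (lexx 0).
by rewrite scale0r !addr0; exact.
Qed.

Definition line (u v : 'rV[R]_n) (t : std_simplex R 1) : 'rV[R]_n :=
  bary 0 t *: u + bary 1 t *: v.

Lemma line_continuous u v : continuous (line u v).
Proof.
move=> t; rewrite /line.
apply: (@continuous_at_add _ _ _ (fun t => bary 0 t *: u) (fun t => bary 1 t *: v));
  apply: continuous_at_scale.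
- exact: bary_continuous.
- exact: cst_continuous.
- exact: bary_continuous.
- exact: cst_continuous.
Qed.

Lemma line_in u v t : cell_image G u -> cell_image G v -> cell_image G (line u v t).
Proof. by apply: cell_convex2; rewrite ?bary_ge0 ?bary1. Qed.

Definition segment (x y : M) : singular_simplex R 1 M :=
  simplex_of (fun t => psi (line (phi x) (phi y) t)).

Lemma continuous_cell (T : topologicalType) (a : T -> 'rV[R]_n) :
  continuous a -> (forall t, cell_image G (a t)) -> continuous (fun t => psi (a t)).
Proof.
move=> ca Ga t; apply: (@continuous_comp _ _ _ a psi); first exact: ca.
by apply: cell_point_continuous; rewrite inE.
Qed.

Lemma segmentE x y : cell_set G x -> cell_set G y ->
  segment x y =1 (fun t => psi (line (phi x) (phi y) t)).
Proof.
move=> Gx Gy; apply: simplex_ofE; apply: continuous_cell.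
  exact: line_continuous.
by move=> t; apply: line_in; exact: cell_coord_in.
Qed.

Lemma segment_start x y : cell_set G x -> cell_set G y -> segment x y (vertex (inord 0)) = x.
Proof.
move=> Gx Gy; rewrite segmentE // /line !bary_vertex //= scale1r scale0r addr0.
exact: cell_coordK.
Qed.

Lemma segment_end x y : cell_set G x -> cell_set G y -> segment x y (vertex (inord 1)) = y.
Proof.
move=> Gx Gy; rewrite segmentE // /line !bary_vertex //= scale1r scale0r add0r.
exact: cell_coordK.
Qed.

(** The segment from x to x is constant; compactness of the 1-simplex makes the
    neighbourhoods of y uniform in the parameter. *)
Lemma near_segment x (B : set M) : cell_set G x -> nbhs x B ->
  \forall y \near x, forall t, B (segment y x t).
Proof.
move=> Gx Bx.
have /compact_near_coveringP K := compact_set_type (@compact_std_simplex R 1).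
have := K M (nbhs x) (fun y t => B (psi (line (phi y) (phi x) t))) _.
have H : forall t : std_simplex R 1, [set: std_simplex R 1] t ->
    \forall t' \near t & y \near x, B (psi (line (phi y) (phi x) t')).
  move=> t _; have xE : psi (line (phi x) (phi x) t) = x.
    by rewrite /line -scalerDl bary1 scale1r cell_coordK.
  have c0 : {for (t, x), continuous (fun p : std_simplex R 1 * M => bary 0 p.1)}.
    apply: (@continuous_comp _ _ _ fst (bary 0)); first exact: cvg_fst.
    exact: bary_continuous.
  have c1 : {for (t, x), continuous (fun p : std_simplex R 1 * M => bary 1 p.1)}.
    apply: (@continuous_comp _ _ _ fst (bary 1)); first exact: cvg_fst.
    exact: bary_continuous.
  have cp : {for (t, x), continuous (fun p : std_simplex R 1 * M => phi p.2)}.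
    apply: (@continuous_comp _ _ _ snd phi); first exact: cvg_snd.
    by apply: cell_coord_continuous; rewrite inE.
  have cl : {for (t, x), continuous
      (fun p : std_simplex R 1 * M => line (phi p.2) (phi x) p.1)}.
    apply: continuous_at_add; apply: continuous_at_scale.
    - exact: c0.
    - exact: cp.
    - exact: c1.
    - exact: cst_continuous.
  have cB : {for (t, x), continuous
      (fun p : std_simplex R 1 * M => psi (line (phi p.2) (phi x) p.1))}.
    apply: (@continuous_comp _ _ _
       (fun p : std_simplex R 1 * M => line (phi p.2) (phi x) p.1) psi); first exact: cl.
    apply: cell_point_continuous; rewrite inE /=.
    by apply: line_in; exact: cell_coord_in.
  by apply: (cB B); rewrite /= xE.
move=> /(_ _ H) near_all.
have Gn : \forall y \near x, cell_set G y by apply: open_nbhs_nbhs; split => //; exact: cell_open.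
by apply: filterS2 near_all Gn => y By Gy t; rewrite segmentE //; exact: By.
Qed.

Variable W : cochain R M 1.
Hypothesis W_cocycle : cocycle W.

Lemma segment_triangle x y z : cell_set G x -> cell_set G y -> cell_set G z ->
  W (segment x z) = W (segment x y) + W (segment y z).
Proof.
move=> Gx Gy Gz.
pose a (t : std_simplex R 2) : M :=
  psi (bary 0 t *: phi x + bary 1 t *: phi y + bary 2 t *: phi z).
have ca : continuous a.
  apply: continuous_cell => t.
    have cb m (v : 'rV[R]_n) : {for t, continuous (fun t => bary m t *: v)}.
      by apply: continuous_at_scale; [exact: bary_continuous|exact: cst_continuous].
    exact: (continuous_at_add (continuous_at_add (cb 0%N (phi x)) (cb 1%N (phi y)))
      (cb 2%N (phi z))).
  by apply: cell_convex; rewrite ?bary_ge0 ?bary2 //; exact: cell_coord_in.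
apply: (cocycle_triangle W_cocycle ca) => t; rewrite segmentE // /a /line; congr psi.
- have := bary_face0 (inord 0) t; have := @bary_face _ _ (inord 0 : 'I_3) t 0 isT.
  have := @bary_face _ _ (inord 0 : 'I_3) t 1 isT.
  by rewrite inordK //= /bump /= => -> -> ->; rewrite scale0r add0r.
- have := bary_face0 (inord 1) t; have := @bary_face _ _ (inord 1 : 'I_3) t 0 isT.
  have := @bary_face _ _ (inord 1 : 'I_3) t 1 isT.
  by rewrite inordK //= /bump /= => -> -> ->; rewrite scale0r addr0.
- have := bary_face0 (inord 2) t; have := @bary_face _ _ (inord 2 : 'I_3) t 0 isT.
  have := @bary_face _ _ (inord 2 : 'I_3) t 1 isT.
  by rewrite inordK //= /bump /= => -> -> ->; rewrite scale0r addr0.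
Qed.

(* The simplicial map from the 2-simplex to the 1-simplex that sends the vertices
   0, 1, 2 to 0, 1, 1. *)
Let collapse_in (t : std_simplex R 2) :
  (\row_i (if i == 0 then bary 0 t else bary 1 t + bary 2 t) : 'rV[R]_2) \in
    std_simplex R 1.
Proof.
rewrite inE; split=> [i|].
  by rewrite mxE; case: ifP => _; rewrite ?addr_ge0 ?bary_ge0.
by rewrite !big_ord_recl big_ord0 !mxE /= addr0 addrA bary2.
Qed.

Let collapse (t : std_simplex R 2) : std_simplex R 1 :=
  exist _ (\row_i (if i == 0 then bary 0 t else bary 1 t + bary 2 t) : 'rV[R]_2)
    (collapse_in t).

Let bary_collapse0 t : bary 0 (collapse t) = bary 0 t.
Proof. by rewrite {1}/bary mxE -val_eqE /= inordK. Qed.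

Let bary_collapse1 t : bary 1 (collapse t) = bary 1 t + bary 2 t.
Proof. by rewrite {1}/bary mxE -val_eqE /= inordK. Qed.

Let collapse_continuous : continuous collapse.
Proof.
apply: continuous_comp_initial => t; apply: mx_continuous_at => i j.
rewrite (_ : (fun u => _) = fun u =>
   if j == 0 then bary 0 u else bary 1 u + bary 2 u); last first.
  by apply/funext => u; rewrite /= mxE.
case: (j == 0); first exact: bary_continuous.
have c1 := @bary_continuous R 2 1 t; have c2 := @bary_continuous R 2 2 t.
exact: (continuousD c1 c2).
Qed.

Let simplex1_eq (t t' : std_simplex R 1) :
  bary 0 t = bary 0 t' -> bary 1 t = bary 1 t' -> t = t'.
Proof.
move=> e0 e1; apply/val_inj/rowP => i; rewrite -(inord_val i).
by case: i => -[|[|//]] ?; [exact: e0|exact: e1].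
Qed.

(** A path in a convex cell is homotopic to the segment with the same ends. The
    homotopy is written as a 2-simplex with faces the path, the segment and a
    constant path. *)
Lemma cocycle_segment (g : singular_simplex R 1 M) :
  (forall t, cell_set G (g t)) ->
  W g = W (segment (g (vertex (inord 0))) (g (vertex (inord 1)))).
Proof.
move=> Gg; set p := g _; set q := g _.
have vE (t : std_simplex R 1) : (bary 0 t = 0 -> g t = q) /\ (bary 1 t = 0 -> g t = p).
  have H := bary1 t; split=> b0.
    rewrite /q; congr (g _); apply: simplex1_eq; rewrite bary_vertex //= ?b0 //.
    by move: H; rewrite b0 add0r.
  rewrite /p; congr (g _); apply: simplex1_eq; rewrite bary_vertex //= ?b0 //.
  by move: H; rewrite b0 addr0.
(* In barycentric coordinates (t0, t1, t2), the 2-simplex is (1 - h) al + h be where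
   al runs through the path and be through the segment, both with parameter
   s = t1 + t2, and h = t2 / (t1 + t2). The face t2 = 0 has h = 0, the face t1 = 0
   has h = 1, and on the face t0 = 0 both al and be are at the end q. *)
pose s (t : std_simplex R 2) : R := bary 1 t + bary 2 t.
pose h t : R := bary 2 t / s t.
have s_ge0 t : 0 <= s t by rewrite addr_ge0 // bary_ge0.
have h_ge0 t : 0 <= h t by rewrite divr_ge0 // bary_ge0.
have h_le1 t : h t <= 1.
  have [s0|s0] := eqVneq (s t) 0; first by rewrite /h s0 invr0 mulr0.
  have s1 : 0 < s t by rewrite lt_def s0 s_ge0.
  by rewrite /h ler_pdivrMr // mul1r lerDr bary_ge0.
pose al t := phi (g (collapse t)).
pose be t := line (phi p) (phi q) (collapse t).
pose a t := al t + h t *: (be t - al t).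
have cal : continuous al.
  move=> t; apply: (@continuous_comp _ _ _ (g \o collapse) phi).
    by apply: continuous_comp; [exact: collapse_continuous|exact: cts_fun].
  by apply: cell_coord_continuous; rewrite inE; exact: Gg.
have cbe : continuous be.
  move=> t; apply: (@continuous_comp _ _ _ collapse (line (phi p) (phi q))).
    exact: collapse_continuous.
  exact: line_continuous.
have ca : continuous a.
  move=> t.
  have cd : {for t, continuous (fun u => be u - al u)}.
    by have cb_ := cbe t; have ca_ := cal t; exact: (continuousB cb_ ca_).
  apply: (@continuous_at_add _ _ _ al (fun u => h u *: (be u - al u))); first exact: cal.
  (* At the vertex s = 0 the ratio h has no limit, but al and be agree there. *)
  have [s0|s0] := eqVneq (s t) 0.
    apply: continuous_at_bounded_scale => //; first by move=> u; rewrite ger0_norm.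
    have b1 : bary 1 (collapse t) = 0 by rewrite bary_collapse1.
    have b0 : bary 0 (collapse t) = 1 by rewrite -(bary1 (collapse t)) b1 addr0.
    rewrite /be /al (vE (collapse t)).2 // /line b0 b1.
    by rewrite scale0r scale1r addr0 subrr.
  apply: (@continuous_at_scale _ _ _ h); last exact: cd.
  have c1 := @bary_continuous R 2 1 t; have c2 := @bary_continuous R 2 2 t.
  have cs : {for t, continuous s} by exact: (continuousD c1 c2).
  exact: (continuousM c2 (continuousV s0 cs)).
have Ga t : cell_image G (a t).
  have -> : a t = (1 - h t) *: al t + h t *: be t.
    by rewrite /a scalerBr scalerBl scale1r addrA addrAC.
  apply: cell_convex2; rewrite ?subr_ge0 ?subrK //.
    by apply: cell_coord_in; exact: Gg.
  by apply: line_in; apply: cell_coord_in; exact: Gg.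
have cpa : continuous (fun t => psi (a t)) by apply: continuous_cell.
have cq : continuous (fun _ : std_simplex R 1 => q) by exact: cst_continuous.
rewrite -[LHS]addr0 -(cocycle_cst W_cocycle (simplex_ofE cq)).
apply/esym; apply: (cocycle_triangle W_cocycle cpa) => t.
- rewrite (simplex_ofE cq).
  have := bary_face0 (inord 0) t; have := @bary_face _ _ (inord 0 : 'I_3) t 0 isT.
  have := @bary_face _ _ (inord 0 : 'I_3) t 1 isT.
  rewrite inordK //= /bump /= => e2 e1 e0.
  set u := face _ t in e0 e1 e2 *.
  have c0 : bary 0 (collapse u) = 0 by rewrite bary_collapse0.
  have c1 : bary 1 (collapse u) = 1 by rewrite bary_collapse1 e1 e2 bary1.
  rewrite /a /al (vE _).1 // /be /line c0 c1 scale0r scale1r add0r subrr scaler0 addr0.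
  by rewrite cell_coordK //; exact: Gg.
- rewrite segmentE; [|exact: Gg|exact: Gg].
  have := bary_face0 (inord 1) t; have := @bary_face _ _ (inord 1 : 'I_3) t 0 isT.
  have := @bary_face _ _ (inord 1 : 'I_3) t 1 isT.
  rewrite inordK //= /bump /= => e2 e1 e0.
  set u := face _ t in e0 e1 e2 *; congr psi.
  have cu : collapse u = t.
    by apply: simplex1_eq; rewrite ?bary_collapse0 ?bary_collapse1 ?e0 ?add0r.
  rewrite /a /be /al cu.
  have [t1|t1] := eqVneq (bary 1 t) 0.
    rewrite (vE _).2 // /line t1 scale0r addr0.
    have -> : bary 0 t = 1 by rewrite -(bary1 t) t1 addr0.
    by rewrite scale1r subrr scaler0 addr0.
  by rewrite /h /s e0 e2 add0r divff // scale1r addrC subrK.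
- have := bary_face0 (inord 2) t; have := @bary_face _ _ (inord 2 : 'I_3) t 0 isT.
  have := @bary_face _ _ (inord 2 : 'I_3) t 1 isT.
  rewrite inordK //= /bump /= => e1 e0 e2.
  set u := face _ t in e0 e1 e2 *.
  have cu : collapse u = t.
    by apply: simplex1_eq; rewrite ?bary_collapse0 ?bary_collapse1 ?e1 ?e2 ?addr0.
  by rewrite /a /h e2 mul0r scale0r addr0 /al cu cell_coordK.
Qed.

End Segments.

(** * Cells, bump functions and a countable partition of unity *)

Section Bumps.
Variables (R : realType) (n : nat).

Lemma norm_dist_continuous (c : 'rV[R]_n) : continuous (fun v : 'rV[R]_n => `|v - c|).
Proof.
move=> v; apply: (@continuous_comp _ _ _ (fun v : 'rV[R]_n => v - c) (fun w => `|w|)).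
  by apply: continuousB; [exact: cvg_id|exact: cst_continuous].
exact: norm_continuous.
Qed.

Lemma compact_norm_ball (c : 'rV[R]_n) (e : R) : compact [set v | `|v - c| <= e].
Proof.
apply: bounded_closed_compact.
  exists (`|c| + e); split; first exact: num_real.
  move=> m cm v /= vc; rewrite -[v](subrK c) (le_trans (ler_normD _ _)) //.
  by rewrite (le_trans _ (ltW cm)) // addrC lerD2l.
apply: (@closed_comp _ _ (fun v : 'rV[R]_n => `|v - c|) [set x | x <= e]).
  by move=> v _; exact: norm_dist_continuous.
exact: closed_le.
Qed.

Lemma norm_ball_convex (p : 'rV[R]_n) (r a b c : R) (u v w : 'rV[R]_n) :
  0 <= a -> 0 <= b -> 0 <= c -> a + b + c = 1 ->
  `|u - p| < r -> `|v - p| < r -> `|w - p| < r ->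
  `|a *: u + b *: v + c *: w - p| < r.
Proof.
move=> a0 b0 c0 abc ur vr wr; set m := Num.max `|u - p| (Num.max `|v - p| `|w - p|).
have mr : m < r by rewrite !gt_max ur vr wr.
have um : `|u - p| <= m by rewrite !le_max lexx.
have vm : `|v - p| <= m by rewrite !le_max lexx orbT.
have wm : `|w - p| <= m by rewrite !le_max lexx !orbT.
apply: le_lt_trans mr; rewrite -[p]scale1r -[in 1 *: p]abc !scalerDl.
rewrite !opprD !addrA.
have -> : a *: u + b *: v + c *: w - a *: p - b *: p - c *: p =
    a *: (u - p) + b *: (v - p) + c *: (w - p).
  rewrite !scalerBr; apply/rowP => j; rewrite !mxE; ring.
rewrite (le_trans (ler_normD _ _)) // (le_trans (lerD (ler_normD _ _) (lexx _))) //.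
rewrite !normrZ !ger0_norm //.
have : a * m + b * m + c * m = m by rewrite -!mulrDl abc mul1r.
move=> <-; apply: lerD; [apply: lerD|]; exact: ler_wpM2l.
Qed.

Variables (M : topologicalType) (A : smooth_atlas R n M).
Hypothesis M_hausdorff : hausdorff_space M.

(** The second condition says that the support of f is contained in G, without
    mentioning closures. *)
Definition is_bump (G : convex_cell R n M) (f : M -> R) : Prop :=
  continuous f /\ forall y, cell_set G y \/ \forall z \near y, f z = 0.

(** In a chart around x, f is a piecewise linear function of the distance to x, equal
    to 1 up to r/3 and to 0 from 2r/3 on, where the ball of radius r lies in the
    image of the chart. Extending f by 0 keeps it continuous because the closed
    ball of radius 2r/3 is compact, hence closed in the Hausdorff space M. *)
Lemma exists_bump (x : M) : exists (G : convex_cell R n M) (f : M -> R),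
  [/\ is_bump G f, cell_set G x & \forall y \near x, f y = 1].
Proof.
have [i ix] := chart_cover A x; set c := chart A i x.
have oi : open (chart A i @` chart_dom A i) by exact: chart_img_open.
have [r r0 ball_i] : exists2 r, 0 < r &
    forall v, `|v - c| < r -> (chart A i @` chart_dom A i) v.
  have /nbhs_ballP [r /= r0 ri] : nbhs c (chart A i @` chart_dom A i).
    by apply: open_nbhs_nbhs; split => //; exists x.
  exists r => // v vr; apply: ri.
  by rewrite -ball_normE /ball_ /= distrC.
pose V : set 'rV[R]_n := [set v | `|v - c| < r].
pose S : set M := [set y | chart_dom A i y /\ V (chart A i y)].
have VP v : V v -> chart_dom A i (chart_inv A i v) /\ chart A i (chart_inv A i v) = v.
  by move=> /ball_i [y iy <-]; rewrite chartK.
have point_in v : V v -> S (chart_inv A i v).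
  by move=> Vv; have [iv vE] := VP v Vv; split; rewrite ?vE.
have chart_cont y : chart_dom A i y -> {for y, continuous (chart A i)}.
  by move=> iy; apply: chart_continuous; rewrite inE.
have near_i y : chart_dom A i y -> \forall z \near y, chart_dom A i z.
  by move=> iy; apply: open_nbhs_nbhs; split => //; exact: chart_dom_open.
have norm_chart y : chart_dom A i y -> {for y, continuous (fun y => `|chart A i y - c|)}.
  move=> iy; apply: (@continuous_comp _ _ _ (chart A i) (fun v => `|v - c|)).
    exact: chart_cont.
  exact: norm_dist_continuous.
have oS : open S.
  rewrite openE => y [iy Vy]; apply: filterI; first exact: near_i.
  by apply: (cvgr_lt _ (norm_chart y iy)).
have inv_cont v : V v -> {for v, continuous (chart_inv A i)}.
  by move=> Vv; apply: chart_inv_continuous; rewrite inE; exact: ball_i.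
pose G : convex_cell R n M := @ConvexCell R n M S V (chart A i) (chart_inv A i)
  (fun y Sy => Sy.2) point_in (fun y Sy => chartK Sy.1) oS
  (fun y Sy => chart_cont y (set_mem Sy).1) (fun v Vv => inv_cont v (set_mem Vv))
  (@norm_ball_convex c r).
pose f y : R := if `[< chart_dom A i y >] then
  clamp (2 - 3 / r * `|chart A i y - c|) else 0.
pose K := chart_inv A i @` [set v | `|v - c| <= 2 / 3 * r].
have KV v : `|v - c| <= 2 / 3 * r -> V v.
  by move=> /le_lt_trans; apply; rewrite gtr_pMl // ltr_pdivrMr // mul1r ltr_nat.
have clK : closed K.
  apply: compact_closed => //; apply: continuous_compact; last exact: compact_norm_ball.
  by apply: continuous_in_subspaceT => v; rewrite inE => /KV; exact: inv_cont.
have f0 y : ~ K y -> f y = 0.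
  move=> nKy; rewrite /f; case: asboolP => // iy.
  have big : 2 / 3 * r < `|chart A i y - c|.
    rewrite ltNge; apply/negP => small; apply: nKy.
    by exists (chart A i y) => //; exact: chartK.
  rewrite /clamp; apply/max_idPl; rewrite ge_min; apply/orP; right.
  rewrite subr_le0 mulrAC ler_pdivlMr //.
  by move: big; lra.
have near_f0 y : ~ K y -> \forall z \near y, f z = 0.
  move=> nKy; have : nbhs y (~` K).
    by apply: open_nbhs_nbhs; split => //; exact: closed_openC.
  by apply: filterS => z; exact: f0.
exists G, f; split.
- split=> y.
    have [iy|niy] := pselect (chart_dom A i y).
      apply: (@near_eq_continuous_at _ _ _ (fun z => clamp (2 - 3 / r * `|chart A i z - c|))).
        by apply: filterS (near_i y iy) => z iz; rewrite /f asboolT.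
      have cin : {for y, continuous (fun z => 2 - 3 / r * `|chart A i z - c|)}.
        apply: continuousB; first exact: cst_continuous.
        by apply: continuousM; [exact: cst_continuous|exact: norm_chart].
      exact: (continuous_comp cin (@clamp_continuous R _)).
    have nKy : ~ K y by move=> [v /KV /VP [iv _] vy]; apply: niy; rewrite -vy.
    apply: (@near_eq_continuous_at _ _ _ (cst 0)); last exact: cst_continuous.
    by apply: filterS (near_f0 y nKy) => z ->.
  have [Sy|nSy] := pselect (S y); first by left.
  right; apply: near_f0 => -[v /KV Vv vy]; apply: nSy; rewrite -vy; exact: (point_in v Vv).
- by split => //; rewrite /V /= subrr normr0.
- have : \forall y \near x, `|chart A i y - c| < r / 3.
    by apply: (cvgr_lt _ (norm_chart x ix)); rewrite subrr normr0 divr_gt0.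
  apply: filterS2 (near_i x ix) => y iy yr; rewrite /f asboolT // /clamp.
  have le1 : 3 / r * `|chart A i y - c| <= 1.
    by rewrite mulrAC ler_pdivrMr // mul1r mulrC -ler_pdivlMr // ltW.
  rewrite (min_idPl _); last by rewrite lerBrDr -lerBrDl; lra.
  by rewrite (max_idPr _).
Qed.

(** For each open set U of a countable basis on which some bump function is 1, one
    such bump function is kept. The number of U serves as its index, and the other
    indices carry arbitrary bump functions. *)
Lemma countable_bumps (x0 : M) : @second_countable M ->
  exists (G : nat -> convex_cell R n M) (f : nat -> M -> R) (p : nat -> M),
    [/\ forall l, is_bump (G l) (f l), forall l, cell_set (G l) (p l) &
        forall y : M, exists l, \forall z \near y, f l z = 1].
Proof.
move=> [B /countable_injP [num num_inj] [B_open B_basis]].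
have [F FP] : exists F : M -> convex_cell R n M * (M -> R), forall x,
    [/\ is_bump (F x).1 (F x).2, cell_set (F x).1 x &
       \forall y \near x, (F x).2 y = 1].
  have H x : exists q : convex_cell R n M * (M -> R),
      [/\ is_bump q.1 q.2, cell_set q.1 x & \forall y \near x, q.2 y = 1].
    by have [G [f Gf]] := exists_bump x; exists (G, f).
  by exists (fun x => sval (cid (H x))) => x; exact: svalP (cid (H x)).
pose Q l x := exists U, [/\ B U, num U = l & forall y, U y -> (F x).2 y = 1].
pose p l := xget x0 (Q l).
exists (fun l => (F (p l)).1), (fun l => (F (p l)).2), p; split=> [l|l|y].
- by have [] := FP (p l).
- by have [] := FP (p l).
have [_ _ fy] := FP y; have [U [BU Uy] Uf] := B_basis y _ fy.
have Qy : Q (num U) y by exists U.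
exists (num U); have [U' [BU' U'U U'1]] := xgetPex x0 (ex_intro _ y Qy).
have UU : U' = U by apply: num_inj; rewrite ?inE.
have : nbhs y U by apply: open_nbhs_nbhs; split => //; exact: B_open.
by apply: filterS => z Uz; apply: U'1; rewrite UU.
Qed.

End Bumps.

(** * The phase function *)

Section Partition.
Variables (R : comRingType) (f : nat -> R).

(** These weights form a locally finite partition of unity as soon as every point has
    a neighbourhood on which some f l is equal to 1: all later weights vanish
    there. *)
Definition telescope_weight (l : nat) : R := f l * \prod_(j < l) (1 - f j).

Lemma sum_telescope_weight L :
  \sum_(l < L) telescope_weight l = 1 - \prod_(j < L) (1 - f j).
Proof.
elim: L => [|L IH]; first by rewrite !big_ord0 subrr.
by rewrite !big_ord_recr /= IH /telescope_weight; ring.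
Qed.

Lemma telescope_weight_eq0 L l : (L <= l)%N -> \prod_(j < L) (1 - f j) = 0 ->
  telescope_weight l = 0.
Proof.
move=> /subnKC <- P0; rewrite /telescope_weight.
by rewrite big_split_ord /= P0 mul0r mulr0.
Qed.

End Partition.

Lemma cos_sin_int (R : realType) (m : int) (x : R) :
  cos (pi * (2 * m)%:~R + x) = cos x /\ sin (pi * (2 * m)%:~R + x) = sin x.
Proof.
have E k (y : R) : pi * (2 * k%:Z)%:~R + y = y + pi *+ 2 *+ k.
  by rewrite intrM -(pmulrn _ k) addrC (_ : 2%:~R = 2%:R) // mulrA !mulr_natr.
case: m => k; last rewrite NegzE.
  by rewrite E !periodicn //; [exact: sinD2pi|exact: cosD2pi].
set y := _ + x; have yE : x = y + pi *+ 2 *+ k.+1.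
  by rewrite /y -E (mulrN 2) mulrNz mulrN addrA subrr add0r.
by rewrite yE !periodicn //; [exact: sinD2pi|exact: cosD2pi].
Qed.

Lemma cos_sin_parity (R : realType) (b : bool) (m : int) (x : R) :
  cos (pi * ((b : nat)%:Z + 2 * m)%:~R + x) = (-1) ^+ b * cos x /\
  sin (pi * ((b : nat)%:Z + 2 * m)%:~R + x) = (-1) ^+ b * sin x.
Proof.
rewrite rmorphD mulrDr [_ + pi * _]addrC -addrA.
have [-> ->] := cos_sin_int m (pi * (b : nat)%:Z%:~R + x).
case: b => /=; last by rewrite mulr0 add0r !mul1r.
by rewrite mulr1 addrC cosDpi sinDpi !mulN1r.
Qed.

Section Phase.
Variables (R : realType) (n d : nat) (M : smooth_manifold R n).
Variable N : M -> 'rV[R]_d.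
Hypothesis N_unit : forall x, N x *m (N x)^T = 1%:M.
Hypothesis N_line : continuous (fun x => (N x)^T *m N x).

Lemma unit_vector_unit x : unit_vector (N x) = N x.
Proof.
have : (sqnorm (N x))%:M = 1%:M :> 'M[R]_1 by rewrite -mulmx_sqnorm.
move=> /(congr1 (fun A : 'M[R]_1 => A 0 0)); rewrite !mxE /= !mulr1n => s1.
by rewrite /unit_vector s1 sqrtr1 invr1 scale1r.
Qed.

Lemma near_dot_neq0 (x : M) : \forall y \near x, dot N x y != 0.
Proof.
have cD : {for x, continuous (fun y => dot N x y ^+ 2)}.
  apply: (continuous_at_dot_sqr N_line); [exact: cst_continuous|exact: cvg_id].
have : \forall y \near x, 0 < dot N x y ^+ 2.
  by apply: (cvgr_gt _ cD); rewrite /= dotxx // expr1n.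
by apply: filterS => y; rewrite lt_def sqrf_eq0 => /andP[].
Qed.

(** The orthogonal projection of N x to the line at y is a section along short
    segments from y to x, so changing the sign of N y according to [flip] amounts to
    choosing the unit vector of this line on the side of N x, which is continuous in
    y. *)
Lemma near_flip_segment (G : convex_cell R n M) x : cell_set G x ->
  \forall y \near x, (-1) ^+ flip N (segment G y x) *: N y =
                     unit_vector (N x *m ((N y)^T *m N y)).
Proof.
move=> Gx; have Gn : \forall y \near x, cell_set G y.
  by apply: open_nbhs_nbhs; split => //; exact: cell_open.
apply: filterS2 Gn (near_segment Gx (near_dot_neq0 x)) => y Gy dot0.
have sc : section_along N (segment G y x)
    (fun t => 1 * dot N ((fun=> x) t) (segment G y x t)).
  apply: (@section_along_near _ _ _ _ N_line _ (fun=> x) (segment G y x) (fun=> 1)) => //.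
    exact: cts_fun.
  by split=> [t|]; [exact: oner_neq0|exact: cst_continuous].
rewrite (flipE N_unit sc) segment_start // segment_end // dotxx // !mul1r mulr1.
rewrite mulmx_proj unit_vector_scale unit_vector_unit; congr (_ *: _).
apply: neqr0_sign; have := dot0 (vertex (inord 0)); by rewrite segment_start.
Qed.

Variables (W : cochain R M 1) (W_cocycle : cocycle W).
Hypothesis W_flip : forall g, exists b : int, W g = (flip N g : nat)%:Z + 2 * b.

(** The phase is exp(i pi theta), with theta the average, for the weights psi l, of
    the local primitives h l of W. The values of W, hence of theta, jump with the
    choice of N, and the jumps of theta modulo 2 are compensated by those of the sign
    of N. *)
Lemma exists_phase : exists c s : M -> R,
  [/\ forall x, c x ^+ 2 + s x ^+ 2 = 1,
      continuous (fun x => c x *: N x) & continuous (fun x => s x *: N x)].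
Proof.
have [[x0]|M0] := pselect (inhabited M); last first.
  exists (fun=> 1), (fun=> 0); split=> x; last 2 first.
  - by case: M0; exists.
  - by case: M0; exists.
  by rewrite expr1n expr0n addr0.
have [G [f [p [fG pG f1]]]] :=
  countable_bumps (atlas M) (@manifold_hausdorff _ _ M) x0 (@manifold_second_countable _ _ M).
pose psi l y := telescope_weight (f^~ y) l.
pose h l y : R := (W (segment (G l) y (p l)))%:~R.
pose th L y := \sum_(l < L) psi l y * h l y.
(* rest L y is the total weight of the indices from L on, so that theta is computed
   with any L for which it vanishes. *)
pose rest L y := \prod_(j < L) (1 - f j y).
have th_eq L L' y : rest L y = 0 -> rest L' y = 0 -> th L y = th L' y.
  wlog LL' : L L' / (L <= L')%N => [wl|rL rL'].
    by case: (leqP L L') => [|/ltnW] LL' rL rL'; [|apply/esym]; exact: wl.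
  rewrite /th -(subnKC LL') big_split_ord /= [X in _ = _ + X]big1 ?addr0 // => l _.
  by rewrite /psi (telescope_weight_eq0 _ rL) ?mul0r // leq_addr.
pose top y : nat := (sval (cid (f1 y))).+1.
have rest_near y : \forall z \near y, rest (top y) z = 0.
  have := svalP (cid (f1 y)); rewrite -/(top y) /=.
  by apply: filterS => z fz; rewrite /rest /top big_ord_recr /= fz subrr mulr0.
pose theta y := th (top y) y.
have key x : exists g : M -> R, {for x, continuous g} /\
    \forall y \near x, cos (pi * theta y) *: N y =
       cos (pi * g y) *: unit_vector (N x *m ((N y)^T *m N y)) /\
     sin (pi * theta y) *: N y =
       sin (pi * g y) *: unit_vector (N x *m ((N y)^T *m N y)).
  have [l0 fl0] := f1 x.
  have Gx : cell_set (G l0) x.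
    have [_ /(_ x) [//|z0]] := fG l0.
    have := nbhs_singleton (filterI fl0 z0) => -[-> /eqP].
    by rewrite oner_eq0.
  (* Near x, each h l with x in G l is kap up to the constant k l, as W takes the same
     value on the segments from y to x of the cells l and l0. The l with x outside G l
     have weight 0 near x. *)
  pose kap y := W (segment (G l0) y x).
  pose k l : R := if `[< cell_set (G l) x >] then (W (segment (G l) x (p l)))%:~R else 0.
  pose L := top x.
  pose g y := \sum_(l < L) psi l y * k l.
  have near_G l : cell_set (G l) x -> \forall y \near x, cell_set (G l) y.
    by move=> Glx; apply: open_nbhs_nbhs; split => //; exact: cell_open.
  have term l : \forall y \near x, psi l y * h l y = psi l y * ((kap y)%:~R + k l).
    rewrite /k; case: asboolP => [Glx|nGlx].
      have nG : nbhs x (cell_set (G l)) by exact: near_G.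
      apply: filterS3 (near_G l Glx) (near_G l0 Gx) (near_segment Gx nG).
      move=> y Gly Gl0y segG; congr (_ * _); rewrite /h /kap.
      rewrite (segment_triangle W_cocycle Gly Glx (pG l)) rmorphD; congr (_%:~R + _).
      rewrite (cocycle_segment W_cocycle segG).
      by rewrite segment_start // segment_end.
    have [_ /(_ x) [//|]] := fG l; apply: filterS => y fy.
    by rewrite /psi /telescope_weight fy !mul0r.
  have terms : \forall y \near x, forall l : 'I_L, psi l y * h l y = psi l y * ((kap y)%:~R + k l).
    by apply: filter_forall => l; exact: term.
  exists g; split.
    apply: continuous_at_sum => l _; apply: continuousM; last exact: cst_continuous.
    apply: continuousM; first by have [cf _] := fG l; exact: cf.
    apply: continuous_at_prod => j _; apply: continuousB; first exact: cst_continuous.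
    by have [cf _] := fG j; exact: cf.
  apply: filterS3 terms (rest_near x) (near_flip_segment Gx) => y termy resty flipy.
  have thE : theta y = (kap y)%:~R + g y.
    rewrite /theta (th_eq _ L) //; last exact: nbhs_singleton (rest_near y).
    rewrite /th (eq_bigr _ (fun l _ => termy l)).
    under eq_bigr do rewrite mulrDr.
    rewrite big_split /= -mulr_suml (sum_telescope_weight (f^~ y)).
    by rewrite -/(rest L y) resty subr0 mul1r.
  have [b kapE] := W_flip (segment (G l0) y x).
  rewrite thE mulrDr /kap kapE; have [-> ->] := cos_sin_parity (flip N (segment (G l0) y x)) b (pi * g y).
  by rewrite -flipy !scalerA [cos _ * _]mulrC [sin _ * _]mulrC.
have unit_cont x : {for x, continuous (fun y => unit_vector (N x *m ((N y)^T *m N y)))}.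
  apply: continuous_at_unit_vector.
    rewrite mulmx_proj dotxx // scale1r; apply/eqP => Nx0.
    have := N_unit x; rewrite Nx0 mul0mx => /(congr1 (fun A : 'M[R]_1 => A 0 0)).
    by rewrite !mxE => /eqP; rewrite eq_sym oner_eq0.
  apply: (@continuous_at_mulmx _ _ x _ _ _ (fun=> N x)); first exact: cst_continuous.
  exact: N_line.
exists (fun x => cos (pi * theta x)), (fun x => sin (pi * theta x)); split=> x.
- exact: cos2Dsin2.
- have [g [cg E]] := key x.
  apply: (near_eq_continuous_at (g := fun y => cos (pi * g y) *: unit_vector (N x *m ((N y)^T *m N y)))).
    by apply: filterS E => y [-> _].
  have cpg : {for x, continuous (fun y => pi * g y)}.
    by apply: continuousM; [exact: cst_continuous|exact: cg].
  apply: (@continuous_at_scale _ _ _ (fun y => cos (pi * g y))); last exact: unit_cont.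
  exact: (continuous_comp cpg (@continuous_cos R _)).
- have [g [cg E]] := key x.
  apply: (near_eq_continuous_at (g := fun y => sin (pi * g y) *: unit_vector (N x *m ((N y)^T *m N y)))).
    by apply: filterS E => y [_ ->].
  have cpg : {for x, continuous (fun y => pi * g y)}.
    by apply: continuousM; [exact: cst_continuous|exact: cg].
  apply: (@continuous_at_scale _ _ _ (fun y => sin (pi * g y))); last exact: unit_cont.
  exact: (continuous_comp cpg (@continuous_sin R _)).
Qed.

End Phase.

Theorem corollary1p4 (R : realType) (n : nat) (M : smooth_manifold R n)
    (hM : immersible n.+1 M)
    (hor : orientable M \/
           (~ orientable M /\ singular_cohomology_vanishes R M 2)) :
  trivial_bundle (complexified_bundle (tangent_bundle M)).
Proof.
have [f fI] := hM.
case: hor => [oM|[_ hM2]].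
  have [N [NN cN]] := exists_continuous_normal_field fI oM.
  apply: (trivial_complexified_tangent (N := N) (c := fun=> 1) (s := fun=> 0) fI NN).
  - by move=> x; rewrite expr1n expr0n addr0.
  - by under eq_fun do rewrite scale1r.
  - by move=> x; under eq_fun do rewrite scale0r; exact: cvg_cst.
have [N [NN cP]] := exists_normal_line fI.
have [W [cW Wflip]] := exists_integral_lift NN.1 cP hM2.
have [c [s [cs1 cc cs]]] := exists_phase NN.1 cP cW Wflip.
exact: (trivial_complexified_tangent fI NN cs1 cc cs).
Qed.
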